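(* Let $m\geq2$ be an integer, let $(\xi_i)_{i\geq1}$ be an i.i.d. sequence taking values in a measurable space $(S,\mathcal{S})$, and let $(\mathbb{B},\|\cdot\|_{\mathbb{B}})$ be an $r$-smooth separable Banach space for some $r\in(1,2]$. Let $h\colon S^m\to\mathbb{B}$ be a measurable function such that for each $\ell_0\in\{1,\dots,m\}$, $$\mathbb{E}\left[h(\xi_{\{1,\dots,m\}})\mid\xi_{\{1,\dots,m\}\setminus\{\ell_0\}}\right]=0.$$ For each $1<p<r$, there exists a constant $K(p,\mathbb{B})$ depending only on $p$ and $\mathbb{B}$ such that $$\sup_{t>0}t^p\,\mathbb{P}\left(\sup_{n\geq m}\frac1{n^{m/p}}\Big\|\sum_{\mathbf{i}\in\operatorname{Inc}^m_n}h(\xi_{\mathbf{i}})\Big\|_{\mathbb{B}}>t\right)\leq K(p,\mathbb{B})\,\mathbb{E}\left[\|h(\xi_{\{1,\dots,m\}})\|_{\mathbb{B}}^p\right].$$ Moreover, $$\lim_{n\to\infty}\frac1{n^{m/p}}\Big\|\sum_{\mathbf{i}\in\operatorname{Inc}^m_n}h(\xi_{\mathbf{i}})\Big\|_{\mathbb{B}}=0\quad\text{a.s.}$$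
   Context: A separable Banach space $(\mathbb{B},\|\cdot\|_{\mathbb{B}})$ is $r$-smooth, $1<r\leq 2$, if there exists an equivalent norm $\|\cdot\|'_{\mathbb{B}}$ on $\mathbb{B}$ such that $\sup_{t>0}\sup_{x,y\in\mathbb{B},\|x\|'_{\mathbb{B}}=\|y\|'_{\mathbb{B}}=1}\frac{\|x+ty\|'_{\mathbb{B}}+\|x-ty\|'_{\mathbb{B}}-2}{t^r}<\infty$. $\operatorname{Inc}^m_n=\{\mathbf{i}=(i_1,\dots,i_m):1\leq i_1<\dots<i_m\leq n\}$; $\xi_{\mathbf{i}}=(\xi_{i_1},\dots,\xi_{i_m})$; for a finite set $J$ of indices, $\xi_J=(\xi_j)_{j\in J}$.
   Formalization: The almost sure convergence is stated under the additional assumption that E[||h(ξ_{1,…,m})||^p] is finite; without it the claim fails, e.g. m=2, h(x,y)=xy with symmetric ξ and P(|ξ|>t)=t^{-q} for t≥1, 1<q<p. *)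

(* Defs.v *)
From HB Require Import structures.
From mathcomp Require Import all_boot all_order all_algebra.
From mathcomp Require Import all_classical all_reals all_analysis.
Set Implicit Arguments.
Unset Strict Implicit.
Unset Printing Implicit Defensive.
Import Order.TTheory GRing.Theory Num.Theory.
Import numFieldNormedType.Exports.
Local Open Scope classical_set_scope.
Local Open Scope ring_scope.

Definition separable (T : topologicalType) : Prop :=
  exists2 D : set T, countable D & dense D.

Definition is_norm (R : realType) (V : lmodType R) (N : V -> R) : Prop :=
  [/\ forall x y, N (x + y) <= N x + N y,
      forall (a : R) x, N (a *: x) = `|a| * N x
    & forall x, N x = 0 -> x = 0].

Definition equivalent_norm (R : realType) (B : normedModType R) (N : B -> R) :
    Prop :=
  is_norm N /\
  exists c C : R, [/\ 0 < c, 0 < C & forall x, c * `|x| <= N x <= C * `|x|].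

(* The double supremum is a single supremum over the triples (t, x, y); it is
   -oo for the zero space, which is therefore smooth. *)
Definition smooth (R : realType) (B : normedModType R) (r : R) : Prop :=
  exists2 N : B -> R, equivalent_norm N &
    (ereal_sup [set z | exists (t : R) (x y : B),
       [/\ 0 < t, N x = 1, N y = 1 &
       z = ((N (x + t *: y) + N (x - t *: y) - 2) / t `^ r)%:E]%R] < +oo)%E.

Definition borel (T : topologicalType) : set (set T) := <<s @open T >>.

Definition borel_measurable d (A : measurableType d) (T : topologicalType)
    (f : A -> T) : Prop :=
  forall U : set T, borel U -> measurable (f @^-1` U).

Definition independent d d' (Omega : measurableType d) (S : measurableType d')
    (R : realType) (P : probability Omega R) (xi : nat -> Omega -> S) : Prop :=
  forall (J : seq nat) (A : nat -> set S), uniq J ->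
    (forall j, measurable (A j)) ->
    P (\big[setI/setT]_(j <- J) (xi j @^-1` A j)) =
    (\prod_(j <- J) P (xi j @^-1` A j))%E.

Definition iid d d' (Omega : measurableType d) (S : measurableType d')
    (R : realType) (P : probability Omega R) (xi : nat -> Omega -> S) : Prop :=
  [/\ forall i, measurable_fun [set: Omega] (xi i),
      independent P xi
    & forall i j (A : set S), measurable A ->
        P (xi i @^-1` A) = P (xi j @^-1` A)].

Definition sigma_of d d' (Omega : measurableType d) (S : measurableType d')
    (xi : nat -> Omega -> S) (J : set nat) : set (set Omega) :=
  <<s \bigcup_(j in J) preimage_set_system [set: Omega] (xi j) measurable >>.

Section Bochner.
Context d (Omega : measurableType d) (R : realType) (P : probability Omega R).
Context (B : normedModType R).
Implicit Types (X Y s : Omega -> B) (v : B).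

Definition simple_fun s : Prop :=
  finite_set (range s) /\ forall v, measurable (s @^-1` [set v]).

Definition simple_integral s : B :=
  \sum_(v \in range s) fine (P (s @^-1` [set v])) *: v.

(* [v] is the Bochner integral of [X]; Borel measurability makes the real
   integrands measurable, and amounts to strong measurability when B is
   separable. *)
Definition is_bochner_integral X v : Prop :=
  borel_measurable X /\
  exists s : nat -> Omega -> B,
    [/\ forall n, simple_fun (s n),
        (\int[P]_w (`|X w - s n w|)%:E)%E @[n --> \oo] --> 0%E
      & simple_integral (s n) @[n --> \oo] --> v].

Definition bochner_integrable X : Prop := exists v, is_bochner_integral X v.

(* [Y] is a version of E[X | G]. *)
Definition is_cond_expectation (G : set (set Omega)) X Y : Prop :=
  [/\ bochner_integrable X, bochner_integrable Y,
      forall U : set B, borel U -> G (Y @^-1` U)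
    & forall A, G A -> exists2 v,
        is_bochner_integral (fun w => \1_A w *: X w) v &
        is_bochner_integral (fun w => \1_A w *: Y w) v].

End Bochner.

(* Indices start at 0: the entries range over 0, ..., n - 1, and a sequence
   (xi_i)_{i >= 1} is represented by k |-> xi_{k+1}. *)
Definition Inc (m n : nat) : {set m.-tuple 'I_n} :=
  [set i | sorted ltn [seq val k | k <- tval i]]%SET.

Definition Usum (S : Type) (V : nmodType) (m : nat) (h : m.-tuple S -> V)
    (x : nat -> S) (n : nat) : V :=
  \sum_(i in Inc m n) h [tuple x (tnth i k) | k < m].

(* Main.v *)
Require Import Defs.
From HB Require Import structures.
From mathcomp Require Import all_boot all_order all_algebra.
From mathcomp Require Import all_classical all_reals all_analysis.
From mathcomp Require Import finmap measurable_realfun ring lra zify.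
Set Implicit Arguments.
Unset Strict Implicit.
Unset Printing Implicit Defensive.
Import Order.TTheory GRing.Theory Num.Theory.
Import numFieldNormedType.Exports.
Local Open Scope classical_set_scope.
Local Open Scope ring_scope.

(** The index sequences are encoded as increasing sequences of naturals ([incs]),
    and a U-statistic of order [m] is read as a martingale in the largest index:
    its [j]-th increment collects the 'C(j, m - 1) tuples whose last entry is [j].

    The constant must not depend on [m].  It does not because every step that
    iterates over the [m] coordinates costs a factor [C ^+ m], whereas the number
    of tuples below [n] is at most [n ^ m / m!]; so the bound that comes out is
    [C ^+ m / m!], which is at most [expR C].

    Let [w'] be an independent copy of [w].  Replacing [h] by the alternating sum
    [symmetrize h] of its values where some coordinates are taken from the copy
    makes the array of summands invariant in law, up to sign, under exchanging a
    variable with its copy.  Hence its sums behave like Rademacher chaoses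
    ([chaos]), for which everything is a finite computation with signs: the
    two-point inequality [two_point] of a smooth norm gives moments
    ([chaos_moment]) and, by freezing a potential at the first exit time, a
    maximal inequality ([maximal_ineq]); summation by parts inserts the weights
    [n ^ (m / p)] ([chaos_weak_type]); summing over dyadic levels then bounds the
    mean of the part of the weighted maximum above a level ([chaos_excess]).

    Conversely the degeneracy of [h] says that integrating the symmetrized sum
    over the copy gives back the original sum.  This is stated for real valued
    functionals only: in a separable space, countably many functionals of norm at
    most one determine the norm ([separable_norming], by Hahn-Banach), so that the
    norm of the original sum is almost surely at most the integral over the copy
    of the norm of the symmetrized one ([norm_le_integral_symmetrize]).

    Given a level [t], the kernel is split at [t j ^ (m / p)], where [j] is the
    largest index ([low] and [high]).  The small part is estimated in [L^r] by the
    chaos bound, the large part in [L^1] by the triangle inequality, and Markov's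
    inequality for the integral over the copy gives [prob_exceeds_le].  It remains
    to sum over [j] for a fixed value of the norm of [h] ([truncation_sum_le]):
    since [1 < p < r], both sums are comparable to [t ^ (1 - p)] times the [p]-th
    power of that norm, which is the weak type bound ([prob_sup_le]).

    For the almost sure convergence the weights are made constant up to index
    [N].  The summands of the convergent series of costs are then damped by
    factors that tend to 0 as [N] grows, so the probability that the weighted
    sums exceed [t] after time [N] tends to 0 ([prob_tail_small]). *)

(** * Power inequalities *)

(** Bernoulli's inequality, from Young's inequality with exponents [s^-1] and
    [(1 - s)^-1]. *)
Lemma powR_le_tangent (R : realType) (s z : R) : 0 < s <= 1 -> 0 <= z ->
  z `^ s <= 1 + s * (z - 1).
Proof.
move=> /andP[s0 s1] z0; have [->|sn1] := eqVneq s 1.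
  by rewrite powRr1//; lra.
have {}s1 : s < 1 by rewrite lt_neqAle sn1.
have := @conjugate_powR R (z `^ s) 1 s^-1 (1 - s)^-1 (powR_ge0 _ _) ler01.
rewrite !invrK mulr1 powR1 -powRrM mulfV ?gt_eqF// powRr1// !invr_gt0.
move=> /(_ s0); rewrite subr_gt0 => /(_ s1) H.
by apply: le_trans (H _) _; lra.
Qed.

Lemma powRN_ge_tangent (R : realType) (s z : R) : 0 <= s -> 0 < z ->
  1 - s * (z - 1) <= z `^ (- s).
Proof.
move=> s0 z0; rewrite /powR gt_eqF//.
apply: le_trans (expR_ge1Dx _).
have : ln (1 + (z - 1)) <= z - 1 by apply: le_ln1Dx; lra.
by rewrite addrC subrK => h; nra.
Qed.

(** Writing the powers as [((1 + z) ^+ 2) `^ (r / 2)] makes the exponent at most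
    one, so that the concave function lies below its tangent at 1, and the linear
    terms in [z] cancel. *)
Lemma powR_sum_diff_le (R : realType) (r z : R) : 1 < r <= 2 -> 0 <= z <= 1 ->
  (1 + z) `^ r + (1 - z) `^ r <= 2 + 2 * z `^ r.
Proof.
move=> /andP[r1 r2] /andP[z0 z1].
have sq (y : R) : 0 <= y -> y `^ r = (y ^+ 2) `^ (r / 2).
  move=> y0; rewrite -powR_mulrn// -powRrM; congr powR.
  by rewrite mulrCA divff ?mulr1.
rewrite sq ?[(1 - z) `^ r]sq ; [|lra..].
have s01 : 0 < r / 2 <= 1 by lra.
have h1 := powR_le_tangent s01 (sqr_ge0 (1 + z)).
have h2 := powR_le_tangent s01 (sqr_ge0 (1 - z)).
have z2 : z ^+ 2 <= z `^ r.
  have [->|zn0] := eqVneq z 0; first by rewrite expr0n/= powR_ge0.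
  have z01 : 0 < z <= 1 by rewrite z1 andbT lt_neqAle eq_sym zn0.
  rewrite -(powR_mulrn _ z0).
  by apply: ger_powR.
apply: le_trans (lerD h1 h2) _.
have : 0 <= z ^+ 2 by apply: sqr_ge0.
by rewrite !expr2 in z2 *; nra.
Qed.

(** * The two-point inequality in a smooth space *)

Section EquivalentNorm.
Context (R : realType) (B : lmodType R) (N : B -> R).
Hypothesis normN : is_norm N.

Lemma is_normD x y : N (x + y) <= N x + N y.
Proof. by case: normN. Qed.

Lemma is_normZ a x : N (a *: x) = `|a| * N x.
Proof. by case: normN. Qed.

Lemma is_normN x : N (- x) = N x.
Proof. by rewrite -scaleN1r is_normZ normrN1 mul1r. Qed.

Lemma is_norm0 : N 0 = 0.
Proof. by rewrite -(scale0r 0) is_normZ normr0 mul0r. Qed.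

Lemma is_norm_ge0 x : 0 <= N x.
Proof. by have := is_normD x (- x); rewrite subrr is_norm0 is_normN; lra. Qed.

Lemma is_norm_eq0 x : N x = 0 -> x = 0.
Proof. by case: normN => _ _; exact. Qed.

End EquivalentNorm.

Definition two_point (R : realType) (B : lmodType R) (N : B -> R) (r C : R) :=
  forall x y, N (x + y) `^ r + N (x - y) `^ r <= 2 * (N x `^ r + C * N y `^ r).

(** The modulus of smoothness controls the mean [a] of [N (x + y)] and
    [N (x - y)]; their deviation from [a] is at most [N y] and is controlled by
    the scalar inequality [powR_sum_diff_le].  Large [y] are trivial. *)
Lemma smooth_two_point (R : realType) (B : normedModType R) (r : R) :
  1 < r <= 2 -> smooth B r ->
  exists2 N : B -> R, equivalent_norm N & exists2 C : R, 1 <= C & two_point N r C.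
Proof.
move=> r12 [N eqN supN]; exists N => //; have [r1 r2] := andP r12.
have [nN _] := eqN.
have N0 := is_norm_ge0 nN.
have [A A0 hA] : exists2 A : R, 0 <= A & forall (t : R) x y, 0 < t -> N x = 1 ->
    N y = 1 -> N (x + t *: y) + N (x - t *: y) <= 2 + A * t `^ r.
  move: supN; set E := ereal_sup _ => supN.
  have [A hA] : exists A : R, (E <= A%:E)%E.
    by case: E supN => [a _||_]; [exists a|rewrite ltxx|exists 0; rewrite leNye].
  exists (Num.max 0 A); first by rewrite le_max lexx.
  move=> t x y t0 Nx Ny.
  have tr : 0 < t `^ r by apply: powR_gt0.
  have : (((N (x + t *: y) + N (x - t *: y) - 2) / t `^ r)%:E <= A%:E)%E.
    by apply: le_trans hA; apply: ereal_sup_ubound; exists t, x, y.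
  rewrite lee_fin ler_pdivrMr// => h.
  have : A * t `^ r <= Num.max 0 A * t `^ r.
    by rewrite (ler_wpM2r (ltW tr))// le_max lexx orbT.
  by lra.
(* the inequality for unit vectors x and y scaled by t *)
pose D := 4 + A + A ^+ 2.
have D4 : 4 <= D by have := sqr_ge0 A; rewrite /D; lra.
have unit t x y : 0 < t -> N x = 1 -> N y = 1 ->
    N (x + t *: y) `^ r + N (x - t *: y) `^ r <= 2 * (1 + D * t `^ r).
  move=> t0 Nx Ny; have tr : 0 < t `^ r by apply: powR_gt0.
  have Nty : N (t *: y) = t by rewrite (is_normZ nN) Ny mulr1 gtr0_norm.
  set u := N (x + t *: y); set v := N (x - t *: y).
  have u0 : 0 <= u := N0 _.
  have v0 : 0 <= v := N0 _.
  have u1 : u <= 1 + t by rewrite -Nx -Nty; apply: is_normD nN _ _.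
  have v1 : v <= 1 + t.
    by rewrite -Nx -Nty -(is_normN nN (t *: y)); apply: is_normD nN _ _.
  have r0 : 0 <= r by lra.
  have [t1|t1] := leP 1 t.
    have pw w : 0 <= w -> w <= 1 + t -> w `^ r <= 4 * t `^ r.
      move=> w0 wt; have : w <= 2 * t by lra.
      move=> /(@ge0_ler_powR _ _ r0 _ _)-/(_ _ _)/le_trans; apply.
      - by rewrite nnegrE.
      - by rewrite nnegrE; lra.
      rewrite powRM ?(ltW t0)// (ler_wpM2r (ltW tr))//.
      apply: (@le_trans _ _ (2 `^ 2)); first by rewrite ler_powR//; lra.
      by rewrite -[2 in X in _ `^ X]/(2%:R) powR_mulrn//; lra.
    have := pw _ u0 u1; have := pw _ v0 v1; nra.
  (* from here on t < 1 *)
  have uv2 : 2 <= u + v.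
    have : N (2 *: x) = 2 by rewrite (is_normZ nN) Nx mulr1 ger0_norm.
    have -> : 2 *: x = (x + t *: y) + (x - t *: y).
      by rewrite addrACA subrr addr0 scaler_nat mulr2n.
    by move=> <-; apply: is_normD nN _ _.
  have uvt : `|u - v| <= 2 * t.
    have dist a b c : N (a + b) <= N (a + c) + N (b - c).
      by apply: le_trans (is_normD nN _ _); rewrite addrACA subrr addr0.
    have h : N (t *: y + t *: y) = 2 * t.
      by rewrite -scalerDl (is_normZ nN) Ny mulr1 ger0_norm; lra.
    have h1 := dist x (t *: y) (- (t *: y)).
    have h2 := dist x (- (t *: y)) (t *: y).
    rewrite opprK h in h1.
    rewrite -opprD (is_normN nN) h in h2.
    by rewrite ler_norml -/u -/v in h1 h2 *; lra.
  have uvA := hA t x y t0 Nx Ny; rewrite -/u -/v in uvA.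
  have trt : t `^ r <= 1.
    have : t `^ r <= 1 `^ r by rewrite ge0_ler_powR// ?nnegrE; lra.
    by rewrite powR1.
  pose a := (u + v) / 2; pose z := `|u - v| / 2 / a.
  have a1 : 1 <= a by rewrite /a; lra.
  have a0 : 0 < a by lra.
  have zt : z <= t.
    rewrite /z ler_pdivrMr//; have : 0 <= `|u - v| by []. by nra.
  have z0 : 0 <= z by rewrite /z !divr_ge0//; lra.
  have z1 : z <= 1 by lra.
  have az : a * z = `|u - v| / 2 by rewrite /z mulrC divfK// gt_eqF.
  have uvE : u `^ r + v `^ r = a `^ r * ((1 + z) `^ r + (1 - z) `^ r).
    rewrite mulrDr -!powRM; [|lra..].
    have -> : a * (1 + z) = Num.max u v.
      rewrite mulrDr mulr1 az /a.
      case: (leP u v) => uv; [rewrite ler0_norm ?subr_le0|rewrite gtr0_norm ?subr_gt0] => //; lra.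
    have -> : a * (1 - z) = Num.min u v.
      rewrite mulrBr mulr1 az /a.
      case: (leP u v) => uv; [rewrite ler0_norm ?subr_le0|rewrite gtr0_norm ?subr_gt0] => //; lra.
    by case: (leP u v) => uv //; rewrite addrC.
  rewrite uvE.
  have z01 : 0 <= z <= 1 by rewrite z0.
  have hz := powR_sum_diff_le r12 z01.
  have zr : z `^ r <= t `^ r.
    by apply: ge0_ler_powR => //; rewrite nnegrE; lra.
  have ar : a `^ r <= 1 + (A + A ^+ 2 / 4) * t `^ r.
    apply: (@le_trans _ _ (a ^+ 2)); first by rewrite -powR_mulrn ?ler_powR//; lra.
    have ha : a <= 1 + A / 2 * t `^ r by rewrite /a; lra.
    apply: (@le_trans _ _ ((1 + A / 2 * t `^ r) ^+ 2)).
      by rewrite lerXn2r// nnegrE; nra.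
    have h : t `^ r * t `^ r <= t `^ r by rewrite -[leRHS]mulr1 ler_wpM2l// (ltW tr).
    have A2 := sqr_ge0 A; rewrite !expr2 in A2 *; nra.
  have ar0 : 0 <= a `^ r by apply: powR_ge0.
  have ar2 : (a / 1) `^ r * t `^ r <= 4 * t `^ r.
    rewrite (ler_wpM2r (ltW tr))// divr1.
    apply: (@le_trans _ _ (2 `^ 2)); last first.
      by rewrite -[2 in X in _ `^ X]/(2%:R) powR_mulrn//; lra.
    apply: (@le_trans _ _ (2 `^ r)); last by rewrite ler_powR//; lra.
    by apply: ge0_ler_powR => //; rewrite ?nnegrE /a; lra.
  rewrite divr1 in ar2.
  have zr0 : 0 <= z `^ r := powR_ge0 _ _.
  have step : a `^ r * ((1 + z) `^ r + (1 - z) `^ r) <= a `^ r * (2 + 2 * t `^ r).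
    by apply: ler_wpM2l => //; lra.
  apply: le_trans step _; rewrite /D.
  have A2 := sqr_ge0 A; have := mulr_ge0 A2 (ltW tr).
  by nra.
exists D; first lra.
move=> x y.
have r0 : r != 0 by rewrite gt_eqF//; lra.
have [Nx0|Nx0] := eqVneq (N x) 0.
  rewrite (is_norm_eq0 nN Nx0) !sub0r !add0r (is_normN nN) (is_norm0 nN) powR0//.
  have := powR_ge0 (N y) r; nra.
have [Ny0|Ny0] := eqVneq (N y) 0.
  by rewrite (is_norm_eq0 nN Ny0) subr0 addr0 (is_norm0 nN) powR0// mulr0 addr0 mulr_natl mulr2n.
have Nxp : 0 < N x by rewrite lt_neqAle eq_sym Nx0 N0.
have Nyp : 0 < N y by rewrite lt_neqAle eq_sym Ny0 N0.
have one w : 0 < N w -> N ((N w)^-1 *: w) = 1.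
  by move=> w0; rewrite (is_normZ nN) gtr0_norm ?invr_gt0// mulVf// gt_eqF.
have := unit (N y / N x) _ _ (divr_gt0 Nyp Nxp) (one _ Nxp) (one _ Nyp).
have yE : N y / N x *: ((N y)^-1 *: y) = (N x)^-1 *: y.
  by rewrite scalerA mulrAC mulfV// mul1r.
rewrite yE -scalerDr -scalerBr !(is_normZ nN) gtr0_norm ?invr_gt0//.
rewrite !powRM ?invr_ge0 ?N0 ?(ltW Nxp)//.
set q := (N x)^-1 `^ r => h.
have q0 : 0 < q by rewrite powR_gt0// invr_gt0.
have qx : q * N x `^ r = 1 by rewrite /q -powRM ?invr_ge0 ?N0// mulVf// powR1.
rewrite -(ler_pM2l q0) mulrDr mulrCA mulrDr qx.
by apply: le_trans h _; rewrite [q * (D * _)]mulrCA [q * _]mulrC.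
Qed.

(** * Increasing index sequences *)

(** The recursion on the upper bound splits off the sequences that end with the
    largest index, as the martingale arguments need. *)
Fixpoint incs (m n : nat) {struct n} : seq (seq nat) :=
  if m is m'.+1 then
    if n is n'.+1 then incs m n' ++ [seq rcons s n' | s <- incs m' n'] else [::]
  else [:: [::]].

Lemma incs0n n : incs 0 n = [:: [::]].
Proof. by case: n. Qed.

Lemma mem_incs m n s :
  (s \in incs m n) = [&& size s == m, sorted ltn s & all (gtn n) s].
Proof.
elim: n m s => [|n IHn] [|m] s /=.
- by case: s.
- by case: s => //= x s; rewrite !andbF.
- by case: s.
rewrite mem_cat IHn; case/lastP: s => [|s x].
  by apply/negbTE/mapP => -[[]].
have -> : (rcons s x \in [seq rcons i n | i <- incs m n]) =
    (x == n) && (s \in incs m n).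
  apply/mapP/andP => [[i ii /rcons_inj[-> ->]] //|[/eqP -> si]].
  by exists s.
rewrite IHn size_rcons eqSS !all_rcons !(sorted_pairwise ltn_trans).
rewrite pairwise_rcons; case: (size s == m) => //=; last by rewrite andbF.
have [sx|] := boolP (all (ltn^~ x) s) => /=; last first.
  by case: eqP => //= -> /negPf sn; rewrite sn andbF.
case: (pairwise ltn s) => /=; last by rewrite andbF.
rewrite !ltnS; case: (ltngtP x n) => [xn|nx|xn] /=; rewrite ?andbF ?orbF //.
- rewrite (sub_all _ sx) ?(sub_all _ sx)//.
  + by move=> y /= /ltn_trans; apply; rewrite ltnW// ltnS.
  + by move=> y /= /ltn_trans; apply.
- by rewrite -xn sx (sub_all _ sx)// => y /=; exact: ltnW.
Qed.

Lemma incs_uniq m n : uniq (incs m n).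
Proof.
elim: n m => [|n IHn] [|m]//=.
rewrite cat_uniq IHn map_inj_uniq ?IHn ?andbT; last first.
  by move=> s t /rcons_inj[].
apply/hasPn => _ /mapP[s _ ->]; rewrite /= mem_incs all_rcons/= ltnn.
by rewrite !andbF.
Qed.

Lemma size_incs m n : size (incs m n) = 'C(n, m).
Proof.
elim: n m => [|n IHn] [|m]//=.
by rewrite size_cat size_map !IHn binS.
Qed.

(** This exhibits a sum over index sequences as a sum of martingale increments. *)
Lemma sum_incsS (V : nmodType) m n (F : seq nat -> V) :
  \sum_(s <- incs m.+1 n) F s =
  \sum_(j < n) \sum_(s <- incs m j) F (rcons s j).
Proof.
elim: n => [|n IHn]; first by rewrite big_nil big_ord0.
by rewrite big_ord_recr -IHn /= big_cat big_map.
Qed.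

Lemma incs_lt m n s k : s \in incs m n -> k \in s -> (k < n)%N.
Proof. by rewrite mem_incs => /and3P[_ _ /allP]; exact. Qed.

(** * Rademacher chaoses *)

Section Signs.
Context (R : realType).
Implicit Types (e : nat -> bool) (F G : (nat -> bool) -> R).

Definition update e n b := fun k => if k == n then b else e k.

(** Expectation over [n] independent fair signs; the coordinates from [n] on are
    frozen.  Averaging the last coordinate first matches the martingale order. *)
Fixpoint avg (n : nat) F : R :=
  if n is n'.+1 then
    avg n' (fun e => (F (update e n' false) + F (update e n' true)) / 2)
  else F (fun=> false).

Lemma avgD n F G : avg n (fun e => F e + G e) = avg n F + avg n G.
Proof.
elim: n F G => //= n IHn F G; rewrite -IHn; congr avg.
by apply/funext => e; lra.
Qed.

Lemma avgZ n c F : avg n (fun e => c * F e) = c * avg n F.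
Proof.
elim: n F => //= n IHn F; rewrite -IHn; congr avg.
by apply/funext => e; lra.
Qed.

Lemma avg_cst n c : avg n (fun=> c) = c.
Proof. by elim: n => //= n IHn; rewrite -[RHS]IHn; congr avg; apply/funext => e; lra. Qed.

Lemma avg_sum n I (s : seq I) (F : I -> (nat -> bool) -> R) :
  avg n (fun e => \sum_(i <- s) F i e) = \sum_(i <- s) avg n (F i).
Proof.
elim: s => [|i s IHs].
  by under eq_fun do rewrite big_nil; rewrite avg_cst big_nil.
by under eq_fun do rewrite big_cons; rewrite avgD IHs big_cons.
Qed.

Lemma le_avg n F G : (forall e, F e <= G e) -> avg n F <= avg n G.
Proof.
elim: n F G => //= n IHn F G FG; apply: IHn => e.
by have := FG (update e n false); have := FG (update e n true); lra.
Qed.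

Lemma avg_ge0 n F : (forall e, 0 <= F e) -> 0 <= avg n F.
Proof. by move=> F0; rewrite -[leLHS](avg_cst n); exact: le_avg. Qed.

Definition sgn (b : bool) : R := (-1) ^+ b.

Definition signs e (s : seq nat) : R := \prod_(k <- s) sgn (e k).

Lemma signs_rcons e s k : signs e (rcons s k) = sgn (e k) * signs e s.
Proof. by rewrite /signs -cats1 big_cat/= big_seq1 mulrC. Qed.

Lemma signs_update e n b m k s : (m <= n)%N -> s \in incs k m ->
  signs (update e n b) s = signs e s.
Proof.
move=> mn si; apply: eq_big_seq => j /(incs_lt si) jm.
by rewrite /update ltn_eqF// (leq_trans jm).
Qed.

Variables (B : lmodType R).

Definition chaos (a : seq nat -> B) (m n : nat) e : B :=
  \sum_(s <- incs m n) signs e s *: a s.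

Lemma chaos_update a m n e k b : (n <= k)%N ->
  chaos a m n (update e k b) = chaos a m n e.
Proof.
by move=> nk; apply: eq_big_seq => s si; rewrite (signs_update _ _ nk si).
Qed.

Lemma chaosS a m n e : chaos a m.+1 n e =
  \sum_(j < n) sgn (e j) *: chaos (fun s => a (rcons s j)) m j e.
Proof.
rewrite /chaos sum_incsS; apply: eq_bigr => j _; rewrite scaler_sumr.
by apply: eq_bigr => s _; rewrite signs_rcons scalerA.
Qed.

Context (N : B -> R) (r C : R).
Hypotheses (normN : is_norm N) (r0 : 0 < r) (C0 : 0 <= C).
Hypothesis smoothN : two_point N r C.

(** Averaging over a sign replaces the conditional Jensen inequality that a general
    martingale would need. *)
Lemma two_point_sgn x y :
  (N (x + sgn false *: y) `^ r + N (x + sgn true *: y) `^ r) / 2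
  <= N x `^ r + C * N y `^ r.
Proof.
by have := smoothN x y; rewrite /sgn expr0 expr1 scale1r scaleN1r; lra.
Qed.

(** Conditioning on the signs below the largest index, one use of the two-point
    inequality costs a factor [C] and lowers the order of the chaos by one. *)
Lemma chaos_moment a m n :
  avg n (fun e => N (chaos a m n e) `^ r)
  <= C ^+ m * \sum_(s <- incs m n) N (a s) `^ r.
Proof.
elim: n m a => [|n IHn] [|m] a.
- rewrite /= /chaos/= !big_seq1 /signs big_nil scale1r expr0 mul1r//.
- by rewrite /= /chaos !big_nil (is_norm0 normN) powR0 ?gt_eqF ?mulr0.
- rewrite /chaos; under eq_fun do rewrite incs0n big_seq1 /signs big_nil scale1r.
  by rewrite avg_cst incs0n big_seq1 expr0 mul1r.
have IH1 := IHn m.+1 a; have IH2 := IHn m (fun s => a (rcons s n)).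
pose X e := chaos a m.+1 n e; pose Y e := chaos (fun s => a (rcons s n)) m n e.
apply: (@le_trans _ _ (avg n (fun e => N (X e) `^ r + C * N (Y e) `^ r))).
  rewrite [X in X <= _]/=; apply: le_avg => e.
  have XY b : chaos a m.+1 n.+1 (update e n b) = X e + sgn b *: Y e.
    rewrite chaosS big_ord_recr -chaosS/= !chaos_update//.
    by rewrite /update eqxx.
  by rewrite !XY; exact: two_point_sgn.
rewrite avgD avgZ /= big_cat big_map mulrDr; apply: lerD => //.
by rewrite exprS -mulrA ler_wpM2l.
Qed.

Section Maximal.
Context (d : nat -> (nat -> bool) -> B) (l : R).
Hypotheses (l0 : 0 < l)
  (d_adapted : forall j k e b, (j <= k)%N -> d j (update e k b) = d j e).

Definition rad_sum n e : B := \sum_(j < n) sgn (e j) *: d j e.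

Lemma rad_sum_update n e k b : (n <= k)%N ->
  rad_sum n (update e k b) = rad_sum n e.
Proof.
move=> nk; apply: eq_bigr => j _; have jk := leq_trans (ltn_ord j) nk.
by rewrite (d_adapted _ _ (ltnW jk)) /update ltn_eqF.
Qed.

Definition exits n e := has (fun k => l < N (rad_sum k e)) (iota 0 n.+1).

(** Freezing the potential at the first exit time keeps it a supermartingale up
    to the increments [C * N (d j) `^ r]. *)
Lemma maximal_ineq n :
  l `^ r * avg n (fun e => (exits n e)%:R)
  <= C * \sum_(j < n) avg j (fun e => N (d j e) `^ r).
Proof.
pose Phi k e := if exits k e then l `^ r else N (rad_sum k e) `^ r.
have exitsS k e : exits k.+1 e = exits k e || (l < N (rad_sum k.+1 e)).
  by rewrite /exits -addn1 iotaD has_cat add0n /= orbF.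
have exits_upd k e b : exits k (update e k b) = exits k e.
  apply: eq_in_has => i; rewrite mem_iota add0n ltnS => /andP[_ ik].
  by rewrite rad_sum_update.
suff PhiE k : avg k (Phi k) <= C * \sum_(j < k) avg j (fun e => N (d j e) `^ r).
  rewrite -avgZ; apply: le_trans (PhiE n); apply: le_avg => e; rewrite /Phi.
  by case: exits; rewrite ?mulr1 ?mulr0 ?powR_ge0.
elim: k => [|k IHk].
  rewrite big_ord0 mulr0 /= /Phi /exits/= /rad_sum big_ord0 (is_norm0 normN).
  by rewrite ltNge (ltW l0)/= powR0// gt_eqF.
rewrite big_ord_recr mulrDr; apply: le_trans (lerD IHk (lexx _)).
rewrite -avgZ -avgD [X in X <= _]/=; apply: le_avg => e.
rewrite /Phi !exitsS !exits_upd; case: (exits k e) => /=.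
  have := mulr_ge0 C0 (powR_ge0 (N (d k e)) r); lra.
apply: le_trans (two_point_sgn (rad_sum k e) (d k e)).
have T b : rad_sum k.+1 (update e k b) = rad_sum k e + sgn b *: d k e.
  rewrite /rad_sum big_ord_recr/= -/(rad_sum k _) rad_sum_update// d_adapted//.
  by rewrite /update eqxx.
have le_pow (x : R) : (if l < x then l `^ r else x `^ r) <= x `^ r.
  case: ifP => // lx; apply: ge0_ler_powR; rewrite ?nnegrE ?(ltW r0) ?(ltW l0) ?(ltW lx) ?(ltW (lt_trans l0 lx))//.
rewrite !T ler_pM2r ?invr_gt0//; exact: lerD (le_pow _) (le_pow _).
Qed.

End Maximal.

(** Summation by parts: dividing the increments by nondecreasing weights beforehand
    dominates dividing the sum by the weight of its last index. *)
Lemma norm_sum_le_weighted (x : nat -> B) (b : nat -> R) (L : R) n :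
  (forall j, 0 < b j) -> {homo b : i j / (i <= j)%N >-> i <= j} ->
  (forall k, (k <= n.+1)%N -> N (\sum_(j < k) (b j)^-1 *: x j) <= L) ->
  N (\sum_(j < n.+1) x j) <= 2 * L * b n.
Proof.
move=> b0 bh; pose T k := \sum_(j < k) (b j)^-1 *: x j.
pose U k := \sum_(j < k) x j.
rewrite -/(U n.+1) => hT.
suff h : forall k, (k <= n)%N -> N (U k.+1 - b k *: T k.+1) <= b k * L.
  rewrite -[U n.+1](subrK (b n *: T n.+1)).
  apply: le_trans (is_normD normN _ _) _.
  rewrite (is_normZ normN) gtr0_norm//.
  have := h n (leqnn _); have := hT n.+1 (leqnn _); rewrite -/(T n.+1).
  by have := b0 n; nra.
have step k : U k.+1 - b k *: T k.+1 = U k - b k *: T k.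
  rewrite /U /T !big_ord_recr/= scalerDr scalerA divff ?gt_eqF// scale1r.
  by rewrite opprD addrACA subrr addr0.
elim=> [_|k IHk kn].
  rewrite step /U /T !big_ord0 scaler0 subr0 (is_norm0 normN).
  apply: mulr_ge0; first exact: ltW.
  by have := hT 0%N isT; rewrite big_ord0 (is_norm0 normN).
rewrite step.
have -> : U k.+1 - b k.+1 *: T k.+1 =
    (U k.+1 - b k *: T k.+1) - (b k.+1 - b k) *: T k.+1.
  by rewrite scalerBl opprB addrA subrK.
apply: le_trans (is_normD normN _ _) _.
have bk : 0 <= b k.+1 - b k by rewrite subr_ge0 bh.
rewrite (is_normN normN) (is_normZ normN) ger0_norm//.
have := IHk (ltnW kn); have := hT k.+1 (leqW kn); rewrite -/(T k.+1).
by nra.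
Qed.

(** The weights are put on the increments, where the maximal inequality for plain
    martingales applies. *)
Lemma chaos_weak_type a m M (b : nat -> R) (l : R) : 0 < l ->
  (forall j, 0 < b j) -> {homo b : i j / (i <= j)%N >-> i <= j} ->
  l `^ r * avg M (fun e =>
     [exists n : 'I_M, 2 * l * b n < N (chaos a m.+1 n.+1 e)]%:R)
  <= C ^+ m.+1 * \sum_(s <- incs m.+1 M) (N (a s) / b (last 0%N s)) `^ r.
Proof.
move=> l0 b0 bh.
pose d j e := (b j)^-1 *: chaos (fun s => a (rcons s j)) m j e.
have dad j k e c : (j <= k)%N -> d j (update e k c) = d j e.
  by move=> jk; rewrite /d chaos_update.
have := maximal_ineq l0 dad M => H.
apply: le_trans (le_trans _ H) _.
  apply: ler_wpM2l; first exact: powR_ge0.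
  apply: le_avg => e; case: existsP => [[n]|_]; last exact: ler0n.
  move=> hn; suff -> : exits d l M e by [].
  apply: contraLR hn => /hasPn noexit; rewrite -leNgt chaosS.
  apply: (@norm_sum_le_weighted
    (fun j => sgn (e j) *: chaos (fun s => a (rcons s j)) m j e) b l n) => // k kn.
  have ki : k \in iota 0 M.+1.
    by rewrite mem_iota add0n ltnS (leq_trans kn)// ltn_ord.
  have := noexit k ki; rewrite -leNgt; apply: le_trans.
  rewrite le_eqVlt; apply/orP; left; apply/eqP; congr N; apply: eq_bigr => j _.
  by rewrite /d !scalerA mulrC.
rewrite sum_incsS exprS -mulrA ler_wpM2l// mulr_sumr; apply: ler_sum => j _.
apply: (@le_trans _ _ (avg j (fun e => ((b j)^-1) `^ r *
    N (chaos (fun s => a (rcons s j)) m j e) `^ r))).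
  apply: le_avg => e; rewrite /d (is_normZ normN) gtr0_norm ?invr_gt0//.
  by rewrite powRM ?invr_ge0 ?(ltW (b0 j))// (is_norm_ge0 normN).
rewrite avgZ; apply: le_trans (ler_wpM2l (powR_ge0 _ _) (chaos_moment _ _ _)) _.
rewrite mulrCA ler_wpM2l ?exprn_ge0// mulr_sumr; apply: ler_sum => s _.
rewrite last_rcons [N _ / _]mulrC powRM ?invr_ge0 ?(ltW (b0 j))//.
exact: is_norm_ge0 normN _.
Qed.

End Signs.

(** * Excess of the weighted maximum of a chaos *)

(** A layer-cake formula with dyadic levels. *)
Lemma dyadic_excess (R : realFieldType) (x c : R) K : 0 < c ->
  Num.min x (2 ^+ K * c) - c <=
  \sum_(k < K) 2 ^+ k * c * (2 ^+ k * c < x)%R%:R.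
Proof.
move=> c0; elim: K => [|K IHK].
  by rewrite big_ord0 expr0 mul1r subr_le0 ge_min lexx orbT.
rewrite big_ord_recr/=; apply: le_trans (lerD IHK (lexx _)).
have k0 : 0 < 2 ^+ K * c by rewrite mulr_gt0// exprn_gt0.
rewrite exprS -mulrA; set y := 2 ^+ K * c in k0 *.
case: (ltP y x) => yx; rewrite ?mulr1 ?mulr0 ?addr0.
  by case: (leP x (2 * y)); case: (leP x y); lra.
by case: (leP x (2 * y)); case: (leP x y); lra.
Qed.

Lemma sum_geometric_le (R : realFieldType) (q : R) K : 0 <= q < 1 ->
  \sum_(k < K) q ^+ k <= (1 - q)^-1.
Proof.
move=> /andP[q0 q1]; rewrite -[leRHS]mul1r.
rewrite ler_pdivlMr ?subr_gt0// mulrC.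
have -> : (1 - q) * \sum_(k < K) q ^+ k = 1 - q ^+ K.
  by rewrite -[in RHS](expr1n _ K) subrXX; congr (_ * _); apply: eq_bigr => k _; rewrite expr1n mul1r.
by rewrite gerBl exprn_ge0.
Qed.

Lemma gt0_powRB (R : realType) (x s t : R) : 0 < x ->
  x `^ (s - t) = x `^ s / x `^ t.
Proof. by move=> x0; rewrite powRB//; apply/implyP => _; rewrite gt_eqF. Qed.

Lemma powR2_lt1 (R : realType) (r : R) : 1 < r -> 2 `^ (1 - r) < 1 :> R.
Proof.
move=> r1; rewrite gt0_powRB// powRr1// ltr_pdivrMr ?powR_gt0// mul1r.
rewrite -[ltLHS]powRr1// /powR gt_eqF// ltr_expR ltr_pM2r// ln_gt0//.
by rewrite ltr1n.
Qed.

Section Excess.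
Context (R : realType).

(** A weak type estimate at all levels above [c / 2] controls the part of [V]
    above [c], because [r > 1] makes the series over dyadic levels converge. *)
Lemma avg_excess_le M (V : (nat -> bool) -> R) (r c Q A : R) : 1 < r -> 0 < c ->
  (forall e, V e <= A) ->
  (forall l, 0 < l -> l `^ r * avg M (fun e => (2 * l < V e)%R%:R) <= Q) ->
  avg M (fun e => Num.max 0 (V e - c)) <=
  2 * (c / 2) `^ (1 - r) * (1 - 2 `^ (1 - r))^-1 * Q.
Proof.
move=> r1 c0 VA weak.
have Q0 : 0 <= Q.
  have := weak 1 ltr01; apply: le_trans; rewrite mulr_ge0 ?powR_ge0//.
  by apply: avg_ge0 => e; exact: ler0n.
have [K KA] : exists K : nat, A <= 2 ^+ K * c.
  exists (Num.bound (A / c)); rewrite -ler_pdivrMr//.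
  have [Ac|Ac] := leP 0 (A / c); last by rewrite ltW// (lt_le_trans Ac)// exprn_ge0.
  apply: (le_trans (ltW (archi_boundP Ac))).
  by rewrite -natrX ler_nat ltnW// ltn_expl.
pose lev k : R := 2 ^+ k * c.
have lev0 k : 0 < lev k by rewrite mulr_gt0// exprn_gt0.
apply: (@le_trans _ _ (avg M (fun e => \sum_(k < K) lev k * (lev k < V e)%R%:R))).
  apply: le_avg => e; rewrite ge_max sumr_ge0/=; last first.
    by move=> k _; rewrite mulr_ge0 ?ler0n// ltW.
  by have := dyadic_excess (V e) K c0; rewrite min_l// (le_trans (VA _)).
rewrite avg_sum.
apply: (@le_trans _ _ (\sum_(k < K) 2 * (c / 2) `^ (1 - r) * Q * (2 `^ (1 - r)) ^+ k)).
  apply: ler_sum => k _; rewrite avgZ.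
  have l0 : 0 < lev k / 2 by rewrite divr_gt0.
  have := weak _ l0; rewrite mulrCA divff// mulr1 mulrC => h.
  have -> : 2 * (c / 2) `^ (1 - r) * Q * 2 `^ (1 - r) ^+ k =
      2 * (lev k / 2) `^ (1 - r) * Q.
    rewrite /lev -[2 ^+ k * c / 2]mulrA [(2 ^+ k * _) `^ _]powRM ?exprn_ge0 ?divr_ge0 ?(ltW c0)//.
    by rewrite -[(2 ^+ k) in RHS]powR_mulrn// powRAC powR_mulrn ?powR_ge0//; ring.
  rewrite gt0_powRB// powRr1 ?(ltW l0)//.
  have lr : 0 < (lev k / 2) `^ r by apply: powR_gt0.
  rewrite -ler_pdivlMr// in h.
  apply: le_trans (ler_wpM2l (ltW (lev0 k)) h) _.
  by rewrite le_eqVlt; apply/orP; left; apply/eqP; field; rewrite ?gt_eqF.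
rewrite -mulr_sumr [leRHS]mulrAC ler_wpM2l//.
  by rewrite !mulr_ge0 ?powR_ge0.
by apply: sum_geometric_le; rewrite powR_ge0/= powR2_lt1.
Qed.

(** The constant is a power of a number that depends on [B] and [r] only; the
    constants lost on passing from the smooth norm to the original one, and on
    summing over levels, are absorbed since the order is at least one. *)
Lemma chaos_excess (B : normedModType R) (r : R) : 1 < r <= 2 -> smooth B r ->
  exists2 C : R, 1 <= C & forall m M (a : seq nat -> B) (b : nat -> R) (c : R),
  0 < c -> (forall j, 0 < b j) -> {homo b : i j / (i <= j)%N >-> i <= j} ->
  avg M (fun e => \big[Num.max/0]_(n < M) (`|chaos a m.+1 n.+1 e| / b n - c))
  <= C ^+ m.+1 * c `^ (1 - r) *
     \sum_(s <- incs m.+1 M) (`|a s| / b (last 0%N s)) `^ r.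
Proof.
move=> r12 smB; have [N [nN [c1 [c2 [c10 c20 cN]]]] [C C1 tp]] :=
  smooth_two_point r12 smB.
have [r1 r2] := andP r12; have r0 : 0 < r by lra.
have N0 := is_norm_ge0 nN.
pose D := c1^-1 * (2 * (c1 / 2) `^ (1 - r) * (1 - 2 `^ (1 - r))^-1 * c2 `^ r).
exists (Num.max 1 D * C); first by rewrite mulr_ege1// le_max lexx.
move=> m M a b c cp b0 bh.
pose U n e := chaos a m.+1 n.+1 e.
pose V e := \big[Num.max/0]_(n < M) (N (U n e) / b n).
pose Q := C ^+ m.+1 * \sum_(s <- incs m.+1 M) (N (a s) / b (last 0%N s)) `^ r.
have C0 : 0 <= C by lra.
have normsum n e : N (U n e) <= \sum_(s <- incs m.+1 n.+1) N (a s).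
  rewrite /U /chaos; elim/big_rec2: _ => [|s x y _ h].
    by rewrite (is_norm0 nN).
  apply: le_trans (is_normD nN _ _) _; rewrite lerD//.
  have s1 : `|signs R e s| = 1.
    rewrite /signs; elim/big_rec: _ => [|k z _ h']; first exact: normr1.
    by rewrite normrM h' mulr1 /sgn normrX normrN1 expr1n.
  by rewrite (is_normZ nN) s1 mul1r.
have weak l : 0 < l -> l `^ r * avg M (fun e => (2 * l < V e)%R%:R) <= Q.
  move=> l0; apply: le_trans (chaos_weak_type nN r0 C0 tp a m M l0 b0 bh).
  rewrite ler_wpM2l ?powR_ge0//; apply: le_avg => e.
  case: existsP => [_|noex]; first by rewrite ler_nat; case: (2 * l < V e)%R.
  rewrite ltNge (_ : V e <= _)//; apply: bigmax_le => [|n _].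
    by rewrite mulr_ge0// ltW.
  rewrite ler_pdivrMr// leNgt; apply/negP => h; apply: noex.
  by exists n.
have VA e : V e <= \big[Num.max/0]_(n < M)
    (\sum_(s <- incs m.+1 n.+1) N (a s) / b n).
  apply: le_bigmax2 => n _; rewrite -mulr_suml ler_wpM2r//.
  by rewrite invr_ge0 ltW.
have cc1 : 0 < c1 * c by apply: mulr_gt0.
have := avg_excess_le r1 cc1 VA weak.
set q := (1 - 2 `^ (1 - r))^-1 => H.
apply: (@le_trans _ _ (c1^-1 * avg M (fun e => Num.max 0 (V e - c1 * c)))).
  rewrite -avgZ; apply: le_avg => e; apply: bigmax_le => [|n _].
    by rewrite mulr_ge0 ?invr_ge0 ?(ltW c10)// le_max lexx.
  have le1 : N (U n e) / b n - c1 * c <= Num.max 0 (V e - c1 * c).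
    rewrite le_max; apply/orP; right; rewrite lerD2r.
    exact: (@le_bigmax _ _ _ 0 (fun n : 'I_M => N (U n e) / b n) n).
  rewrite -[leLHS](mulKf (lt0r_neq0 c10)) ler_pM2l ?invr_gt0//.
  apply: le_trans le1; rewrite mulrBr lerD2r mulrA ler_wpM2r ?invr_ge0 ?(ltW (b0 n))//.
  by case/andP: (cN (U n e)).
apply: le_trans (ler_wpM2l _ H) _; first by rewrite invr_ge0 ltW.
have q0 : 0 <= q.
  by rewrite invr_ge0 subr_ge0 ltW// powR2_lt1.
apply: (@le_trans _ _ (D * C ^+ m.+1 * c `^ (1 - r) *
     \sum_(s <- incs m.+1 M) (`|a s| / b (last 0%N s)) `^ r)).
  have S : \sum_(s <- incs m.+1 M) (N (a s) / b (last 0%N s)) `^ r <=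
      c2 `^ r * \sum_(s <- incs m.+1 M) (`|a s| / b (last 0%N s)) `^ r.
    rewrite mulr_sumr; apply: ler_sum => s _.
    have bs := b0 (last 0%N s).
    rewrite -powRM ?divr_ge0 ?(ltW bs) ?(ltW c20)//.
    have as0 : 0 <= `|a s| / b (last 0%N s) by rewrite divr_ge0// ltW.
    apply: ge0_ler_powR; rewrite ?nnegrE ?(ltW r0)//.
    - by rewrite divr_ge0 ?N0 ?(ltW bs).
    - by rewrite mulr_ge0// ltW.
    by rewrite mulrA ler_wpM2r ?invr_ge0 ?(ltW bs)//; case/andP: (cN (a s)).
  have -> : (c1 * c / 2) `^ (1 - r) = (c1 / 2) `^ (1 - r) * c `^ (1 - r).
    by rewrite mulrAC [LHS]powRM ?(ltW cp)// divr_ge0// ltW.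
  rewrite /Q /D.
  set Z := (_ * _ * q) in H *.
  rewrite [leRHS](_ : _ = c1^-1 * (2 * ((c1 / 2) `^ (1 - r) * c `^ (1 - r)) * q *
    (C ^+ m.+1 * (c2 `^ r * \sum_(s <- incs m.+1 M) (`|a s| / b (last 0%N s)) `^ r)))); last by rewrite /q; ring.
  rewrite ler_wpM2l ?invr_ge0 ?(ltW c10)// ler_wpM2l//.
    by rewrite !mulr_ge0 ?powR_ge0.
  by rewrite ler_wpM2l// exprn_ge0.
rewrite ler_wpM2r//.
  by apply: sumr_ge0 => s _; apply: powR_ge0.
rewrite ler_wpM2r ?powR_ge0// exprMn ler_wpM2r ?exprn_ge0//.
apply: (@le_trans _ _ (Num.max 1 D)); first by rewrite le_max lexx orbT.
by apply: ler_eXnr => //; rewrite le_max lexx.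
Qed.

End Excess.

(** * Norming functionals *)

Definition dominated_functional (R : realType) (B : normedModType R)
    (f : B -> R) : Prop :=
  (forall a u v, f (a *: u + v) = a * f u + f v) /\ (forall v, `|f v| <= `|v|).

Section HahnBanach.
Context (R : realType) (B : normedModType R).

(** A partial functional is represented by its graph; the bound by the norm makes
    such a linear relation single-valued. *)
Let partial_functional (x : B) (G : set (B * R)) : Prop :=
  [/\ forall a p q, G p -> G q -> G (a *: p.1 + q.1, a * p.2 + q.2),
      forall p, G p -> p.2 <= `|p.1|
    & forall p, G p -> G (x, `|x|)].

(** Hahn-Banach for the functional [t x |-> t `|x|], by Zorn's lemma on graphs. *)
Lemma hahn_banach_norm (x : B) :
  exists2 f : B -> R, dominated_functional f & f x = `|x|.
Proof.
have [|G [[Glin Gdom Gx] Gmax]] := @Zorn_bigcup _ (partial_functional x).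
  move=> F Fp Ftot; split.
  - move=> a p q [G1 F1 Gp] [G2 F2 Gq].
    case: (Ftot _ _ F1 F2) => sub.
      by exists G2 => //; have [+ _ _] := Fp _ F2; apply=> //; exact: sub.
    by exists G1 => //; have [+ _ _] := Fp _ F1; apply=> //; exact: sub.
  - by move=> p [G FG Gp]; have [_ + _] := Fp _ FG; exact.
  - move=> p [G FG Gp]; have [_ _ Gx] := Fp _ FG; exists G => //.
    exact: Gx Gp.
have {}Gx : G (x, `|x|).
  have [[p /Gx//]|/forallNP G0] := pselect (exists p, G p).
  (* a maximal graph is not empty: it could be extended to the line of x *)
  exfalso; apply: (Gmax [set p | exists t, p = (t *: x, t * `|x|)]).
    split => [|sub]; first by move=> p /G0.
    by apply: (G0 (x, `|x|)); apply: sub; exists 1; rewrite scale1r mul1r.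
  split.
  - move=> a _ _ [s ->] [t ->]; exists (a * s + t) => /=.
    by rewrite scalerDl scalerA mulrDl mulrA.
  - move=> _ [t ->] /=; rewrite normrZ ler_wpM2r//; exact: ler_norm.
  - by move=> _ _; exists 1; rewrite scale1r mul1r.
have G0 : G (0, 0).
  by have := Glin (-1) _ _ Gx Gx; rewrite /= scaleN1r mulN1r !addNr.
have Guniq v s t : G (v, s) -> G (v, t) -> s = t.
  move=> Gs Gt; apply/eqP; rewrite eq_le.
  have h s' t' : G (v, s') -> G (v, t') -> s' <= t'.
    move=> Gs' Gt'; have := Gdom _ (Glin (-1) _ _ Gt' Gs').
    by rewrite /= scaleN1r mulN1r addNr normr0 addrC subr_le0.
  by rewrite !h.
have GN v s : G (v, s) -> G (- v, - s).
  move=> Gv; have := Glin (-1) _ _ Gv G0.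
  by rewrite /= scaleN1r mulN1r !addr0.
have GZ a v s : G (v, s) -> G (a *: v, a * s).
  by move=> Gv; have := Glin a _ _ Gv G0; rewrite /= !addr0.
have Gtot y : exists s, G (y, s).
  (* the value at y must separate the lower bounds from the upper bounds *)
  pose L' := [set z : R | exists v s, G (v, s) /\ z = s - `|v - y|].
  (* every lower bound is below every upper bound, so c can be a supremum *)
  have LU v s v' s' : G (v, s) -> G (v', s') -> s - `|v - y| <= `|v' + y| - s'.
    move=> Gv Gv'; rewrite lerBrDr addrAC lerBlDr.
    have := Gdom _ (Glin 1 _ _ Gv Gv'); rewrite /= scale1r mul1r => /le_trans; apply.
    rewrite (_ : v + v' = (v' + y) + (v - y)) ?ler_normD//.
    by rewrite addrACA subrr addr0 addrC.
  pose c := sup L'.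
  have supL : has_sup L'.
    split; first by exists (0 - `|0 - y|), 0, 0.
    by exists (`|0 + y| - 0) => _ [v [s [Gv ->]]]; exact: LU.
  have cL v s : G (v, s) -> s - `|v - y| <= c.
    by move=> Gv; apply: sup_upper_bound => //; exists v, s.
  have cU v s : G (v, s) -> c <= `|v + y| - s.
    move=> Gv; apply: ge_sup; first by case: supL.
    by move=> _ [v' [s' [Gv' ->]]]; exact: LU.
  pose G' := [set p | exists v s t, G (v, s) /\ p = (v + t *: y, s + t * c)].
  have GG' : G `<=` G'.
    by move=> [v s] Gv; exists v, s, 0; rewrite scale0r mul0r !addr0.
  have G'y : G' (y, c) by exists 0, 0, 1; rewrite scale1r mul1r !add0r.
  have [/(_ _ G'y)|nsub] := pselect (G' `<=` G); first by exists c.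
  exfalso; apply: (Gmax G'); first by split.
  split.
  - move=> a _ _ [v [s [t [Gv ->]]]] [v' [s' [t' [Gv' ->]]]].
    exists (a *: v + v'), (a * s + s'), (a * t + t'); split; first exact: (Glin a (v, s) (v', s')).
    rewrite /=; congr pair; last by ring.
    by rewrite scalerDr scalerDl scalerA addrACA.
  - move=> _ [v [s [t [Gv ->]]]] /=.
    have [t0|t0|->] := ltgtP t 0; last first.
    + by rewrite scale0r mul0r !addr0; exact: (Gdom (v, s)).
    + have := cU _ _ (GZ t^-1 _ _ Gv).
      rewrite -(ler_pM2l t0) mulrBr mulVKf ?gt_eqF// -[t in t * `|_|]gtr0_norm// -normrZ.
      by rewrite scalerDr scalerA mulfV ?gt_eqF// scale1r; lra.
    + have nt0 : 0 < - t by lra.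
      have := cL _ _ (GZ (- t)^-1 _ _ Gv).
      rewrite -(ler_pM2l nt0) mulrBr mulVKf ?gt_eqF// -[X in X * `|_|]gtr0_norm// -normrZ.
      by rewrite scalerBr scalerA mulfV ?gt_eqF// scale1r scaleNr opprK; lra.
  - by move=> _ _; exact: GG'.
have [f fG] := choice Gtot.
exists f; last exact: Guniq (fG _) Gx.
have flin a u v : f (a *: u + v) = a * f u + f v.
  exact: Guniq (fG _) (Glin a _ _ (fG u) (fG v)).
split=> // v; rewrite ler_norml.
apply/andP; split; last exact: Gdom (fG v).
by rewrite lerNl -normrN; exact: (Gdom _ (GN _ _ (fG v))).
Qed.

End HahnBanach.

Section DominatedFunctional.
Context (R : realType) (B : normedModType R) (f : B -> R).
Hypothesis fdom : dominated_functional f.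

Lemma dom_fun0 : f 0 = 0.
Proof. by have := fdom.1 (-1) 0 0; rewrite scaler0 addr0; lra. Qed.

Lemma dom_funD u v : f (u + v) = f u + f v.
Proof. by have := fdom.1 1 u v; rewrite scale1r mul1r. Qed.

Lemma dom_funZ a u : f (a *: u) = a * f u.
Proof. by have := fdom.1 a u 0; rewrite !addr0 dom_fun0 addr0. Qed.

Lemma dom_funB u v : f (u - v) = f u - f v.
Proof. by rewrite dom_funD -scaleN1r dom_funZ mulN1r. Qed.

Lemma dom_fun_sum I (s : seq I) (F : I -> B) :
  f (\sum_(i <- s) F i) = \sum_(i <- s) f (F i).
Proof. by elim/big_rec2: _ => [|i x y _ <-]; rewrite ?dom_fun0 ?dom_funD. Qed.

Lemma dom_fun_le v : f v <= `|v|.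
Proof. exact: le_trans (ler_norm _) (fdom.2 v). Qed.

Lemma dom_fun_continuous : continuous f.
Proof.
move=> x; apply/cvgrPdist_le => e e0; near=> y.
rewrite -dom_funB; apply: le_trans (fdom.2 _) _.
by near: y; apply: cvgr_dist_le => //; exact: cvg_id.
Unshelve. all: by end_near.
Qed.

Lemma dom_funN : dominated_functional (fun v => - f v).
Proof.
split=> [a u v|v]; first by rewrite fdom.1; ring.
by rewrite normrN; exact: fdom.2.
Qed.

End DominatedFunctional.

Definition norming (R : realType) (B : normedModType R) (f : nat -> B -> R) :=
  (forall k, dominated_functional (f k)) /\
  forall v (e : R), 0 < e -> exists k, `|v| <= f k v + e.

(** The functionals that norm the points of a dense sequence norm every point, as
    they are 1-Lipschitz. *)
Lemma separable_norming (R : realType) (B : normedModType R) :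
  separable B -> exists f : nat -> B -> R, norming f.
Proof.
move=> [D /countable_injP[g ginj] Ddense].
pose d n : B := xget 0 [set v | D v /\ g v = n].
have dg v : D v -> d (g v) = v.
  move=> Dv; have := @xgetPex _ (0 : B) [set w | D w /\ g w = g v].
  rewrite -/(d (g v)) => /(_ (ex_intro _ v (conj Dv erefl)))[Dd gd].
  by apply: ginj => //; exact: mem_set.
have hb n : exists f : B -> R, dominated_functional f /\ f (d n) = `|d n|.
  by have [f fdom fd] := hahn_banach_norm (d n); exists f.
have [f fP] := choice hb.
exists f; split => [k|v e e0]; first by have [] := fP k.
have e2 : 0 < e / 2 by rewrite divr_gt0.
have [w [vw Dw]] : (ball v (e / 2))° `&` D !=set0.
  apply: Ddense; last exact: open_interior.
  by exists v; apply: nbhsx_ballx.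
have {}vw : `|v - w| < e / 2.
  by move/interior_subset: vw; rewrite -ball_normE.
have [fdom fd] := fP (g w); rewrite (dg _ Dw) in fd.
exists (g w).
have h1 : `|v| <= `|w| + `|v - w| by rewrite -[X in `|X| <= _](subrK w) addrC ler_normD.
have h2 : f (g w) (w - v) <= `|v - w| by rewrite distrC; exact: dom_fun_le.
rewrite (dom_funB fdom) fd in h2; lra.
Qed.

(** * Measurability and Bochner integrals through functionals *)

(** The norm is the supremum of countably many measurable functions: this is how
    separability makes the norm of a sum of random vectors measurable. *)
Lemma measurable_norming (R : realType) (B : normedModType R)
    (f : nat -> B -> R) d (T : measurableType d) (X : T -> B) :
  norming f -> (forall k, measurable_fun setT (f k \o X)) ->
  measurable_fun setT (fun w => `|X w|).
Proof.
move=> [fdom fsup] mX.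
have ub v : has_ubound (range (f ^~ v)).
  by exists `|v| => _ [k _ <-]; exact: dom_fun_le.
rewrite (_ : (fun w => `|X w|) = fun w => sups ((fun k w => f k (X w)) ^~ w) 0).
  by apply: measurable_fun_sups => // t _; exact: ub.
apply/funext => w; rewrite /sups /sdrop /=.
rewrite (_ : [set _ | _ in _] = range (f ^~ (X w))); last first.
  by apply/seteqP; split=> _ [k _ <-]; exists k.
apply/eqP; rewrite eq_le; apply/andP; split.
  apply/ler_addgt0Pr => e e0; have [k hk] := fsup (X w) _ e0.
  by apply: le_trans hk _; rewrite lerD2r; apply: ub_le_sup => //; exists k.
apply: ge_sup; first by exists (f 0%N (X w)), 0%N.
by move=> _ [k _ <-]; exact: dom_fun_le.
Qed.

Lemma measurable_dom_fun (R : realType) (B : normedModType R) (f : B -> R)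
    d (T : measurableType d) (X : T -> B) :
  dominated_functional f -> borel_measurable X -> measurable_fun setT (f \o X).
Proof.
move=> fdom mX; apply: (measurability _ (RGenOInfty.measurableE R)) => //.
move=> _ [_ [x ->] <-]; rewrite setTI comp_preimage; apply: mX.
apply: sub_sigma_algebra; apply: open_comp; last exact: interval_open.
by move=> y _; exact: dom_fun_continuous.
Qed.

Section BochnerFunctional.
Context d (Omega : measurableType d) (R : realType) (P : probability Omega R).
Context (B : normedModType R).

Lemma measurable_simple_fun (s : Omega -> B) (g : B -> R) : simple_fun s ->
  measurable_fun setT (g \o s).
Proof.
move=> [fin ms] _ Y _; rewrite setTI.
rewrite (_ : _ @^-1` _ = \bigcup_(v in range s `&` [set v | Y (g v)]) s @^-1` [set v]).
  by apply: fin_bigcup_measurable => //; exact: finite_setIl.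
by apply/seteqP; split=> [w Yw|w [v [_ Yv] /= ->]] //; exists (s w); split => //; exists w.
Qed.

Lemma integral_simple_fun (s : Omega -> B) (f : B -> R) :
  dominated_functional f -> simple_fun s ->
  P.-integrable setT (EFin \o f \o s) /\
  (\int[P]_w (f (s w))%:E)%E = (f (simple_integral P s))%:E.
Proof.
move=> fdom [fin ms]; pose r := fset_set (range s).
have fE : EFin \o f \o s = fun w =>
    (\sum_(v <- r) ((f v)%:E * (\1_(s @^-1` [set v]) w)%:E))%E.
  apply/funext => w /=.
  have rw : s w \in r by rewrite in_fset_set//; apply/mem_set; exists w.
  rewrite (big_fsetD1 (s w))//= indicE mem_set// mule1 big1_fset ?adde0//.
  move=> v; rewrite in_fsetD1 => /andP[vs _] _; rewrite indicE memNset ?mule0//=.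
  by move=> vw; rewrite -vw eqxx in vs.
have int v : P.-integrable setT
    (fun w => ((f v)%:E * (\1_(s @^-1` [set v]) w)%:E)%E).
  by apply: integrableZl => //; apply: integrable_indic.
split; first by rewrite fE; exact: integrable_sum.
rewrite -[LHS]/(integral _ _ (EFin \o f \o s)) fE integral_sum//.
rewrite /simple_integral fsbig_finite//= -/r dom_fun_sum// -sumEFin.
apply: eq_bigr => v _; rewrite integralZl//; last exact: integrable_indic.
by rewrite integral_indic// setIT dom_funZ// EFinM fineK ?fin_num_measure// muleC.
Qed.

(** Approximating simple functions converge in [L^1], hence so do their images
    under a functional dominated by the norm. *)
Lemma bochner_integral_functional (phi : nat -> B -> R) (f : B -> R)
    (X : Omega -> B) v : norming phi -> dominated_functional f ->
  P.-integrable setT (EFin \o f \o X) -> is_bochner_integral P X v ->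
  (\int[P]_w (f (X w))%:E)%E = (f v)%:E.
Proof.
move=> nphi fdom intX [mX [s [ss Xs sv]]].
pose c := fine (\int[P]_w (f (X w))%:E).
have cE : (\int[P]_w (f (X w))%:E)%E = c%:E.
  by rewrite /c fineK//; exact: integrable_fin_num intX.
rewrite cE; congr EFin.
have fs : f (simple_integral P (s n)) @[n --> \oo] --> f v.
  by apply: cvg_comp sv _; exact: dom_fun_continuous.
have fc : f (simple_integral P (s n)) @[n --> \oo] --> c.
  apply/cvgrPdist_le => e e0.
  move/fine_cvgP : Xs => [fin /cvgrPdist_lt/(_ _ e0)].
  apply: filterS2 fin => n fin.
  rewrite sub0r normrN /= => Ie.
  have [ints fsE] := integral_simple_fun fdom (ss n).
  have intD := integrableB measurableT intX ints.
  have cfE : (c - f (simple_integral P (s n)))%:E =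
      (\int[P]_w ((f (X w))%:E - (f (s n w))%:E))%E.
    by rewrite integralB//= cE fsE.
  rewrite -lee_fin -abse_EFin cfE.
  apply: le_trans (le_abse_integral P measurableT _) _.
    exact: measurable_int intD.
  apply: (@le_trans _ _ (\int[P]_w (`|X w - s n w|)%:E)%E); last first.
    rewrite -[leLHS]fineK// lee_fin ltW// (le_lt_trans _ Ie)//; exact: ler_norm.
  apply: ge0_le_integral => //.
  - by apply: measurableT_comp => //; exact: measurable_int intD.
  - apply/measurable_EFinP; apply: (measurable_norming nphi) => k.
    have kdom := nphi.1 k.
    rewrite (_ : _ \o _ = (phi k \o X) \- (phi k \o s n)); last first.
      by apply/funext => w /=; rewrite dom_funB.
    apply: measurable_funB; first exact: measurable_dom_fun.
    exact: measurable_simple_fun.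
  - by move=> w _; rewrite -EFinB abse_EFin lee_fin -dom_funB//; exact: fdom.2.
exact: cvg_unique fc fs.
Qed.

End BochnerFunctional.

(** * The law of an i.i.d. sequence *)

Section SequenceSpace.
Context d (S : measurableType d).

Definition cylinder (A : nat -> set S) : set (nat -> S) :=
  [set x | forall k, A k (x k)].

Definition cylinders : set (set (nat -> S)) :=
  [set C | exists A L, [/\ forall k, measurable (A k),
     forall k, (L <= k)%N -> A k = setT & C = cylinder A]].

(** The product sigma-algebra. *)
Definition seq_space := g_sigma_algebraType cylinders.

Lemma measurable_seq_coord k : measurable_fun [set: seq_space] (fun x => x k).
Proof.
move=> _ A mA; rewrite setTI; apply: sub_sigma_algebra.
exists (fun j => if j == k then A else setT), k.+1; split.
- by move=> j; case: ifP.
- by move=> j kj; rewrite gtn_eqF.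
- apply/seteqP; split=> x /=; first by move=> Ax j; case: eqP => // ->.
  by move=> /(_ k); rewrite eqxx.
Qed.

Lemma measurable_seq d' (T : measurableType d') (Z : T -> seq_space) :
  (forall k, measurable_fun setT (fun w => Z w k)) -> measurable_fun setT Z.
Proof.
move=> mZ; apply: (@measurability _ _ T seq_space setT Z cylinders erefl).
move=> _ [_ [A [L [mA _ ->]]] <-]; rewrite setTI.
rewrite (_ : _ @^-1` _ = \bigcap_k ((fun w => Z w k) @^-1` A k)); last first.
  by apply/seteqP; split=> [w Zw k _|w Zw k]; [exact: Zw|exact: (Zw k I)].
apply: bigcapT_measurable => k.
by have := mZ k measurableT _ (mA k); rewrite setTI.
Qed.

Lemma setI_closed_cylinders : setI_closed cylinders.
Proof.
move=> _ _ [A [L [mA AT ->]]] [A' [L' [mA' AT' ->]]].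
exists (fun k => A k `&` A' k), (maxn L L'); split.
- by move=> k; exact: measurableI.
- by move=> k; rewrite geq_max => /andP[Lk Lk']; rewrite AT// AT'// setIT.
- apply/seteqP; split=> x; first by move=> [h h'] k; split.
  by move=> h; split=> k; have [] := h k.
Qed.

End SequenceSpace.

(** Independence is given for families indexed by sequences without repetition, and
    an injection maps an initial segment to such a sequence. *)
Lemma iid_cylinder d d' (Omega : measurableType d) (S : measurableType d')
    (R : realType) (P : probability Omega R) (xi : nat -> Omega -> S)
    (sigma : nat -> nat) (A : nat -> set S) L :
  iid P xi -> injective sigma -> (forall k, measurable (A k)) ->
  (forall k, (L <= k)%N -> A k = setT) ->
  P ((fun w k => xi (sigma k) w) @^-1` cylinder A) =
  (\prod_(k < L) P (xi 0%N @^-1` A k))%E.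
Proof.
move=> [mxi ind eqlaw] sinj mA AT.
pose J := [seq sigma k | k <- iota 0 L].
(* the event imposed on variable sigma k, read off from the position of sigma k *)
pose A' j := A (index j J).
have sA' k : (k < L)%N -> A' (sigma k) = A k.
  by move=> kL; rewrite /A' index_map// -[X in index X _](nth_iota 0 0 kL) index_uniq ?size_iota ?iota_uniq.
have := ind J A'; rewrite map_inj_uniq ?iota_uniq// => /(_ isT (fun j => mA _)).
have iE : iota 0 L = index_iota 0 L by rewrite /index_iota subn0.
rewrite !big_map iE !big_mkord => indE.
transitivity (P (\big[setI/setT]_(k < L) (xi (sigma k) @^-1` A' (sigma k)))).
  congr (P _); apply/seteqP; split=> w.
    by move=> h; rewrite -(bigcap_mkord L (fun k => xi (sigma k) @^-1` A' (sigma k))) => k kL; rewrite /= sA'//; exact: h.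
  rewrite -(bigcap_mkord L (fun k => xi (sigma k) @^-1` A' (sigma k))) => h k /=; have [kL|Lk] := ltnP k L.
    by have := h k kL; rewrite /= sA'.
  by rewrite AT.
rewrite indE; apply: eq_bigr => k _; rewrite sA'//.
exact: eqlaw.
Qed.

(** The rectangles are stable under intersection, and independence computes the
    probability of a rectangle from the marginal law. *)
Lemma iid_law d1 d2 d' (O1 : measurableType d1) (O2 : measurableType d2)
    (S : measurableType d') (R : realType) (P1 : probability O1 R)
    (P2 : probability O2 R) (xi1 : nat -> O1 -> S) (xi2 : nat -> O2 -> S)
    (sigma : nat -> nat) (F : seq_space S -> \bar R) :
  iid P1 xi1 -> iid P2 xi2 ->
  (forall A, measurable A -> P1 (xi1 0%N @^-1` A) = P2 (xi2 0%N @^-1` A)) ->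
  injective sigma -> measurable_fun setT F ->
  (\int[P1]_w F (fun k => xi1 (sigma k) w) = \int[P2]_w F (fun k => xi2 k w))%E.
Proof.
move=> iid1 iid2 law12 sinj mF.
pose Z1 : O1 -> seq_space S := fun w k => xi1 (sigma k) w.
pose Z2 : O2 -> seq_space S := fun w k => xi2 k w.
have mZ1 : measurable_fun setT Z1.
  by apply: measurable_seq => k; have [mxi _ _] := iid1; exact: mxi.
have mZ2 : measurable_fun setT Z2.
  by apply: measurable_seq => k; have [mxi _ _] := iid2; exact: mxi.
pose X1 : {mfun O1 >-> seq_space S} := HB.pack Z1 (isMeasurableFun.Build _ _ _ _ _ mZ1).
pose X2 : {mfun O2 >-> seq_space S} := HB.pack Z2 (isMeasurableFun.Build _ _ _ _ _ mZ2).
have eq12 A : measurable A -> distribution P1 X1 A = distribution P2 X2 A.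
  apply: (@measure_unique _ R (seq_space S) (@cylinders _ S) (fun=> setT)) => //.
  - exact: setI_closed_cylinders.
  - move=> _; exists (fun=> setT), 0%N; split => //.
    by apply/seteqP; split.
  - by rewrite bigcup_const//; exists 0%N.
  - move=> _ [A' [L [mA AT ->]]].
    transitivity (\prod_(k < L) P1 (xi1 0%N @^-1` A' k))%E.
      exact: (iid_cylinder iid1 sinj mA AT).
    under eq_bigr do rewrite law12//.
    by rewrite -(iid_cylinder iid2 (@inj_id nat) mA AT).
  - by move=> _; apply: (le_lt_trans (probability_le1 (distribution P1 X1) measurableT)); rewrite ltry.
have ge0 (G : seq_space S -> \bar R) : measurable_fun setT G -> (forall x, 0 <= G x)%E ->
    (\int[P1]_w G (Z1 w) = \int[P2]_w G (Z2 w))%E.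
  move=> mG G0.
  rewrite -[LHS](@ge0_integral_distribution _ _ _ _ R P1 X1 G)//.
  rewrite -[RHS](@ge0_integral_distribution _ _ _ _ R P2 X2 G)//.
  by apply: eq_measure_integral => A mA _; exact: eq12.
rewrite -[LHS]/(\int[P1]_w (F \o Z1) w)%E -[RHS]/(\int[P2]_w (F \o Z2) w)%E.
rewrite integralE [RHS]integralE (funepos_comp F Z1) (funepos_comp F Z2) (funeneg_comp F Z1) (funeneg_comp F Z2); congr (_ - _)%E.
  by apply: (ge0 (F^\+)%E) => [|x]; [exact: measurable_funepos|exact: funepos_ge0].
by apply: (ge0 (F^\-)%E) => [|x]; [exact: measurable_funeneg|exact: funeneg_ge0].
Qed.

Section Interleaving.
Context d d' (Omega : measurableType d) (S : measurableType d').
Context (R : realType) (P : probability Omega R) (xi : nat -> Omega -> S).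

(** Even entries are the variables, odd entries their copies.  Interleaving gives a
    single i.i.d. sequence, so that mixing or exchanging variables and copies is
    an injective reindexing, to which [iid_law] applies. *)
Definition interleave (k : nat) (w : Omega * Omega) : S :=
  xi k./2 (if odd k then w.2 else w.1).

Hypothesis iidxi : iid P xi.

Lemma measurable_interleave k : measurable_fun setT (interleave k).
Proof.
have [mxi _ _] := iidxi; rewrite /interleave.
by case: odd; apply: measurableT_comp => //; exact: mxi.
Qed.

Lemma interleave_marginal k A : measurable A ->
  (P \x P)%E (interleave k @^-1` A) = P (xi 0%N @^-1` A).
Proof.
move=> mA; have [mxi _ eqlaw] := iidxi.
have mxiA j : measurable (xi j @^-1` A).
  by have := mxi j measurableT A mA; rewrite setTI.
rewrite /interleave; case: (odd k).
  rewrite (_ : _ @^-1` _ = setT `*` (xi k./2 @^-1` A)); last first.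
    by apply/seteqP; split=> [w /= ?|w /= []].
  by rewrite product_measure1E// [X in (X * _)%E](probability_setT P) mul1e; exact: eqlaw.
rewrite (_ : _ @^-1` _ = (xi k./2 @^-1` A) `*` setT); last first.
  by apply/seteqP; split=> [w /= ?|w /= []].
by rewrite product_measure1E// [X in (_ * X)%E](probability_setT P) mule1; exact: eqlaw.
Qed.

(** The even and the odd constraints form a measurable rectangle. *)
Lemma iid_interleave : iid (P \x P)%E interleave.
Proof.
have [mxi ind eqlaw] := iidxi.
have mA1 j A : measurable A -> measurable (xi j @^-1` A).
  by move=> mA; have := mxi j measurableT A mA; rewrite setTI.
split; first exact: measurable_interleave; last first.
  by move=> i j A mA; transitivity (P (xi 0%N @^-1` A)); [|symmetry];
     exact: interleave_marginal.
move=> J A uJ mA.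
pose half b := [seq j./2 | j <- J & odd j == b].
have uhalf b : uniq (half b).
  rewrite map_inj_in_uniq ?filter_uniq// => i j.
  rewrite !mem_filter => /andP[/eqP ib _] /andP[/eqP jb _] ij.
  by rewrite -[i]odd_double_half -[j]odd_double_half ib jb ij.
pose rect b := \big[setI/setT]_(j <- half b) (xi j @^-1` A (b + j.*2)%N).
have -> : \big[setI/setT]_(j <- J) (interleave j @^-1` A j) = rect false `*` rect true.
  rewrite /rect /half !big_map !big_filter.
  rewrite (eq_bigr (fun j => xi j./2 @^-1` A j)); last first.
    by move=> j /eqP jb; congr (_ @^-1` A _); rewrite -[RHS](odd_double_half j) jb.
  rewrite [X in _ `*` X](eq_bigr (fun j => xi j./2 @^-1` A j)); last first.
    by move=> j /eqP jb; congr (_ @^-1` A _); rewrite -[RHS](odd_double_half j) jb.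
  elim: {uJ half uhalf rect} J => [|j J IHJ]; first by rewrite !big_nil setXTT.
  rewrite !big_cons IHJ /interleave; case: (odd j) => /=.
    by apply/seteqP; split=> [w [? []]|w [? []]].
  by apply/seteqP; split=> [w [? []]|w [[]]].
have mrect b : measurable (rect b).
  by apply: bigsetI_measurable => j _; apply: mA1.
have Prect b : P (rect b) = (\prod_(j <- half b) P (xi j @^-1` A (b + j.*2)%N))%E.
  by apply: (ind (half b) (fun j => A (b + j.*2)%N)) => // j; exact: mA.
apply: (eq_trans (product_measure1E P P (mrect false) (mrect true))).
rewrite [X in (X * _)%E]Prect [X in (_ * X)%E]Prect.
transitivity (\prod_(j <- J) P (xi 0%N @^-1` A j))%E; last first.
  by apply: eq_bigr => j _; symmetry; exact: interleave_marginal.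
rewrite /half !big_map !big_filter [RHS](bigID (fun j => odd j == false)) /=.
congr (_ * _)%E.
  apply: eq_bigr => j /eqP jb; rewrite (eqlaw _ 0%N)//.
  by congr (P (_ @^-1` A _)); rewrite -[RHS](odd_double_half j) jb.
apply: eq_big => [j|j /eqP jb]; first by case: odd.
rewrite (eqlaw _ 0%N)//; congr (P (_ @^-1` A _)).
by rewrite -[RHS](odd_double_half j) jb.
Qed.

End Interleaving.

(** * A sequence interleaved with its copy *)

(** Needed to apply [iid_law] to finitely many indices. *)
Lemma extend_injection m (f : 'I_m -> nat) : injective f ->
  exists2 sigma : nat -> nat, injective sigma & forall k : 'I_m, sigma k = f k.
Proof.
move=> finj; pose b := (\max_(i < m) f i).+1.
pose sigma k := if insub k is Some i then f i else (b + k)%N.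
have sE (k : 'I_m) : sigma k = f k by rewrite /sigma valK.
have fb i : (f i < b)%N by rewrite ltnS; exact: leq_bigmax.
exists sigma => // j k; rewrite /sigma.
case: insubP => [i _ <-|_]; case: insubP => [i' _ <-|_].
- by move/finj ->.
- by move=> E; have := fb i; rewrite E ltnNge leq_addr.
- by move=> E; have := fb i'; rewrite -E ltnNge leq_addr.
- exact: addnI.
Qed.

Lemma measurable_tuple_fun d d' (T : measurableType d) (S : measurableType d')
    m (F : 'I_m -> T -> S) : (forall k, measurable_fun setT (F k)) ->
  measurable_fun setT (fun w => [tuple F k w | k < m]).
Proof.
move=> mF; apply/measurable_fun_tnthP => i.
by rewrite (_ : _ \o _ = F i)//; apply/funext => w /=; rewrite tnth_mktuple.
Qed.

Section Kernel.
Context d d' (Omega : measurableType d) (S : measurableType d').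
Context (R : realType) (P : probability Omega R) (xi : nat -> Omega -> S).
Context (m : nat).
Hypothesis iidxi : iid P xi.

Definition seq_tuple (x : nat -> S) (s : seq nat) : m.-tuple S :=
  [tuple x (nth 0%N s k) | k < m].

(** The coordinates selected by [I] use the copies: [I k] is the parity. *)
Definition pick_tuple (z : nat -> S) (s : seq nat) (I : {ffun 'I_m -> bool}) :
    m.-tuple S :=
  [tuple z (I k + (nth 0%N s k).*2)%N | k < m].

Definition pairs (w : Omega * Omega) : nat -> S := fun k => interleave xi k w.

Lemma tnth_pick_tuple_pairs w s I k :
  tnth (pick_tuple (pairs w) s I) k =
  xi (nth 0%N s k) (if I k then w.2 else w.1).
Proof.
rewrite tnth_mktuple /pairs /interleave half_bit_double.
by rewrite oddD odd_double addbF; case: (I k).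
Qed.

Lemma measurable_xi k : measurable_fun setT (xi k).
Proof. by have [mxi _ _] := iidxi; exact: mxi. Qed.

Lemma measurable_seq_tuple s :
  measurable_fun setT (fun w => seq_tuple (xi ^~ w) s).
Proof. by apply: measurable_tuple_fun => k; exact: measurable_xi. Qed.

Lemma measurable_pick_tuple s I :
  measurable_fun setT (fun w => pick_tuple (pairs w) s I).
Proof.
by apply: measurable_tuple_fun => k; exact: (measurable_interleave iidxi).
Qed.

Definition first_tuple (w : Omega) : m.-tuple S := [tuple xi k w | k < m].

Lemma measurable_first_tuple : measurable_fun setT first_tuple.
Proof. by apply: measurable_tuple_fun => k; exact: measurable_xi. Qed.

(** The picked entries are distinct terms of one i.i.d. sequence. *)
Lemma first_tuple_law (s : seq nat) (I : {ffun 'I_m -> bool})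
    (F : m.-tuple S -> \bar R) n : s \in incs m n -> measurable_fun setT F ->
  (\int[P \x P]_w F (pick_tuple (pairs w) s I) =
   \int[P]_w F (first_tuple w))%E.
Proof.
rewrite mem_incs => /and3P[/eqP szs sorts _] mF.
have us : uniq s by apply: sorted_uniq sorts; [exact: ltn_trans|exact: ltnn].
have [|sigma sinj sE] := @extend_injection m (fun k => I k + (nth 0%N s k).*2)%N.
  move=> j k /(congr1 half); rewrite !half_bit_double => E.
  by apply/val_inj/eqP; rewrite -(nth_uniq 0%N _ _ us) ?szs ?ltn_ord// E.
pose G : seq_space S -> \bar R := fun x => F [tuple x k | k < m].
have mG : measurable_fun setT G.
  apply: measurableT_comp => //; apply: measurable_tuple_fun => k.
  exact: measurable_seq_coord.
have law12 A : measurable A -> (P \x P)%E (interleave xi 0%N @^-1` A) = P (xi 0%N @^-1` A).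
  by move=> mA; exact: interleave_marginal.
have := iid_law (iid_interleave iidxi) iidxi law12 sinj mG => <-.
apply: eq_integral => w _; rewrite /G; congr F.
by apply: eq_from_tnth => k; rewrite !tnth_mktuple sE.
Qed.

(** Putting a constant in place of the coordinate [l] does not change the event. *)
Lemma sigma_of_preimage (l : 'I_m) (A : set (m.-tuple S)) : measurable A ->
  (forall x y, (forall k, k != l -> tnth x k = tnth y k) -> A x -> A y) ->
  sigma_of xi [set j | (j < m)%N /\ j <> l] (first_tuple @^-1` A).
Proof.
move=> mA Al; set J := [set j | _]; rewrite /sigma_of; set G := \bigcup_(_ in _) _.
pose psi (w : g_sigma_algebraType G) : m.-tuple S :=
  [tuple if k == l then point else xi k w | k < m].
have mpsi : measurable_fun setT psi.
  apply: measurable_tuple_fun => k; have [kl|kl] := eqVneq k l; first exact: measurable_cst.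
  move=> _ C mC; apply: sub_sigma_algebra; exists (val k); last by exists C.
  by split; [exact: ltn_ord|move/val_inj/eqP; apply/negP].
have := mpsi measurableT A mA; rewrite setTI (_ : psi @^-1` A = first_tuple @^-1` A)//.
by apply/seteqP; split=> w /=; apply: Al => k kl; rewrite !tnth_mktuple (negbTE kl).
Qed.

End Kernel.

(** * Degeneracy and symmetrization *)

Lemma ae_forall_count d (T : measurableType d) (R : realType)
    (mu : {measure set T -> \bar R}) (I : countType) (Q : I -> T -> Prop) :
  (forall i, {ae mu, forall w, Q i w}) -> {ae mu, forall w, forall i, Q i w}.
Proof.
move=> aeQ.
have : {ae mu, forall w, forall n, if choice.unpickle n is Some i then Q i w else True}.
  apply: ae_foralln => n; case: choice.unpickle => [i|]; first exact: aeQ.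
  by apply: filterE.
by apply: filterS => w Qw i; have := Qw (choice.pickle i); rewrite choice.pickleK.
Qed.

Lemma measurable_integral_section d1 d2 (T1 : measurableType d1)
    (T2 : measurableType d2) (R : realType)
    (mu : {sigma_finite_measure set T2 -> \bar R}) (F : T1 * T2 -> \bar R) :
  measurable_fun setT F -> measurable_fun setT (fun x => \int[mu]_y F (x, y))%E.
Proof.
move=> mF.
rewrite (_ : (fun _ => _) = fun x =>
    (\int[mu]_y (F^\+ (x, y)) - \int[mu]_y (F^\- (x, y)))%E); last first.
  apply/funext => x; rewrite -[LHS]/(\int[mu]_y (F \o pair x) y)%E integralE.
  by rewrite (funepos_comp F (pair x)) (funeneg_comp F (pair x)).
apply: emeasurable_funB.
  apply: (measurable_fun_fubini_tonelli_F (m2 := mu) (F^\+)%E).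
    exact: measurable_funepos.
  by move=> x; exact: funepos_ge0.
apply: (measurable_fun_fubini_tonelli_F (m2 := mu) (F^\-)%E).
  exact: measurable_funeneg.
by move=> x; exact: funeneg_ge0.
Qed.

Section Degenerate.
Context d d' (Omega : measurableType d) (S : measurableType d').
Context (R : realType) (P : probability Omega R) (xi : nat -> Omega -> S).
Context (m : nat) (B : normedModType R) (h : m.-tuple S -> B).
Context (phi : nat -> B -> R).
Hypothesis iidxi : iid P xi.
Hypothesis nphi : norming phi.
Hypothesis mh : borel_measurable h.
Hypothesis deg : forall l : 'I_m,
  is_cond_expectation P (sigma_of xi [set j | (j < m)%N /\ j <> l])
    (fun w => h (first_tuple xi m w)) (fun=> 0).
Hypothesis inth : P.-integrable setT (fun w => (`|h (first_tuple xi m w)|)%:E).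

Let mfirst := measurable_first_tuple (m := m) iidxi.

Section Functional.
Context (f : B -> R).
Hypothesis fdom : dominated_functional f.

Lemma measurable_fh : measurable_fun setT (f \o h).
Proof. exact: measurable_dom_fun. Qed.

Lemma integrable_fh :
  P.-integrable setT (fun w => (f (h (first_tuple xi m w)))%:E).
Proof.
apply: (le_integrable measurableT _ _ inth) => [|w _].
  apply/measurable_EFinP; exact: (measurableT_comp measurable_fh mfirst).
by rewrite !abse_EFin lee_fin normr_id; exact: fdom.2.
Qed.

Lemma integrable_fh_pick s I n : s \in incs m n ->
  (P \x P)%E.-integrable setT (fun w => (f (h (pick_tuple (pairs xi w) s I)))%:E).
Proof.
move=> sn; have mf := measurable_fh.
apply/integrableP; split.
  apply/measurable_EFinP; apply: (measurableT_comp mf).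
  exact: (measurable_pick_tuple iidxi).
have mF : measurable_fun setT (fun y => `|(f (h y))%:E|%E).
  by apply: measurableT_comp => //; apply/measurable_EFinP.
rewrite (first_tuple_law iidxi I sn mF).
by have /integrableP[_ H] := integrable_fh; exact: H.
Qed.

(** The hypothesis on the conditional expectation, tested against a functional and
    against an event that ignores the coordinate [l]. *)
Lemma degenerate_functional (l : 'I_m) (A : set (m.-tuple S)) : measurable A ->
  (forall x y, (forall k, k != l -> tnth x k = tnth y k) -> A x -> A y) ->
  (\int[P]_w (\1_A (first_tuple xi m w) * f (h (first_tuple xi m w)))%:E = 0)%E.
Proof.
move=> mA Al; have [_ _ _ hA] := deg l.
have mA' : measurable (first_tuple xi m @^-1` A).
  by have := mfirst measurableT mA; rewrite setTI.
have [v Xv Yv] := hA _ (sigma_of_preimage mA Al).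
have fv0 : f v = 0.
  have : (\int[P]_w (f ((\1_(first_tuple xi m @^-1` A) w : R) *: (0 : B)))%:E)%E = (f v)%:E.
    apply: (bochner_integral_functional nphi fdom) Yv.
    rewrite (_ : _ \o _ = cst 0%E); first exact: integrable0.
    by apply/funext => w /=; rewrite scaler0 dom_fun0.
  under eq_integral do rewrite scaler0 dom_fun0//.
  by rewrite integral0 => -[].
have fE w : f ((\1_(first_tuple xi m @^-1` A) w : R) *: h (first_tuple xi m w)) =
    \1_A (first_tuple xi m w) * f (h (first_tuple xi m w)).
  by rewrite dom_funZ.
have intX : P.-integrable setT (EFin \o f \o
    (fun w => (\1_(first_tuple xi m @^-1` A) w : R) *: h (first_tuple xi m w))).
  apply: (le_integrable measurableT _ _ integrable_fh) => [|w _].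
    apply/measurable_EFinP; rewrite [X in measurable_fun _ X](_ : _ = fun w =>
      \1_(first_tuple xi m @^-1` A) w * f (h (first_tuple xi m w))); last first.
      by apply/funext => w /=; rewrite fE.
    apply: measurable_funM; first exact: measurable_indic.
    exact: (measurableT_comp measurable_fh mfirst).
  rewrite /= fE lee_fin normrM indicE.
  by case: (_ \in _); rewrite ?normr1 ?normr0 ?mul1r ?mul0r.
have := bochner_integral_functional nphi fdom intX Xv.
rewrite fv0 => X0; apply: eq_trans X0.
by apply: eq_integral => w _; rewrite fE.
Qed.

(** The conditional expectation given the variables of the original sequence
    only is a function [g] of the coordinates outside [I]; testing the
    degeneracy hypothesis on the event where [g] is positive shows that its
    positive part vanishes. *)
Lemma degenerate_section_le0 s (I : {ffun 'I_m -> bool}) n (l : 'I_m) : s \in incs m n -> I l ->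
  {ae P, forall w,
    (\int[P]_w' (f (h (pick_tuple (pairs xi (w, w')) s I)))%:E <= 0)%E}.
Proof.
move=> sn Il.
pose mix (x : m.-tuple S * Omega) : m.-tuple S :=
  [tuple if I k then xi (nth 0%N s k) x.2 else tnth x.1 k | k < m].
have mmix : measurable_fun setT mix.
  apply: measurable_tuple_fun => k; case: (I k).
    by apply: measurableT_comp => //; exact: (measurable_xi iidxi).
  by apply: (measurableT_comp (measurable_tnth k)).
pose g y := (\int[P]_w' (f (h (mix (y, w'))))%:E)%E.
have mg : measurable_fun setT g.
  apply: (measurable_integral_section P (F := fun x => (f (h (mix x)))%:E)).
  by apply/measurable_EFinP; exact: (measurableT_comp measurable_fh mmix).
pose A := [set y | (0 < g y)%E].
have mA : measurable A by rewrite -[A]setTI; exact: emeasurable_fun_o_infty.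
have gext x y : (forall k, ~~ I k -> tnth x k = tnth y k) -> g x = g y.
  move=> xy; apply: eq_integral => w' _; congr (f (h _))%:E.
  apply: eq_from_tnth => k; rewrite !tnth_mktuple; case: ifPn => //; exact: xy.
have Al x y : (forall k, k != l -> tnth x k = tnth y k) -> A x -> A y.
  move=> xy; rewrite /A /= (gext x y)// => k Ik; apply: xy.
  by apply: contraNneq Ik => ->.
pose pk w := pick_tuple (pairs xi w) s I.
have pkE w w' : pk (w, w') = mix (seq_tuple m (xi ^~ w) s, w').
  apply: eq_from_tnth => k; rewrite tnth_pick_tuple_pairs !tnth_mktuple/=.
  by case: (I k).
have gpk w w' : g (pk (w, w')) = g (seq_tuple m (xi ^~ w) s).
  apply: gext => k Ik.
  by rewrite tnth_pick_tuple_pairs tnth_mktuple (negbTE Ik).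
pose psi y := (\1_A y * f (h y))%:E.
have mpsi : measurable_fun setT psi.
  apply/measurable_EFinP; apply: measurable_funM; last exact: measurable_fh.
  exact: measurable_indic.
have intpsi : (P \x P)%E.-integrable setT (fun w => psi (pk w)).
  apply: (le_integrable measurableT _ _ (integrable_fh_pick I sn)) => [|w _].
    by apply: (measurableT_comp mpsi); exact: (measurable_pick_tuple iidxi).
  rewrite /psi !abse_EFin lee_fin normrM indicE.
  by case: (_ \in _); rewrite ?normr1 ?normr0 ?mul1r ?mul0r.
have psi0 : (\int[P \x P]_w psi (pk w) = 0)%E.
  by rewrite (first_tuple_law iidxi I sn mpsi); exact: degenerate_functional mA Al.
have FE w : fubini_F P (fun w => psi (pk w)) w = maxe (g (seq_tuple m (xi ^~ w) s)) 0.
  rewrite /fubini_F; have [gw|gw] := leP (g (seq_tuple m (xi ^~ w) s)) 0%E.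
    apply: integral0_eq => w' _; rewrite /psi indicE memNset ?mul0r//.
    by rewrite /A /= gpk; apply/negP; rewrite -leNgt.
  apply: eq_integral => w' _; rewrite /psi indicE mem_set ?mul1r ?pkE//.
  by rewrite /A /= -pkE gpk.
have := integral12_prod_meas1 intpsi; rewrite psi0 => int0.
have mF := measurable_fubini_F intpsi.
have : ae_eq P setT (fubini_F P (fun w => psi (pk w))) (cst 0%E).
  apply/(ae_eq_integral_abs P measurableT mF); rewrite -[RHS]int0.
  by apply: eq_integral => w _; rewrite gee0_abs// FE le_max lexx orbT.
apply: filterS => w /(_ Logic.I); rewrite FE => /= max0.
rewrite -max0 le_max; apply/orP; left.
rewrite le_eqVlt; apply/orP; left; apply/eqP.
by apply: eq_integral => w' _; rewrite -pkE.
Qed.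

Lemma degenerate_section_eq0 s (I : {ffun 'I_m -> bool}) n (l : 'I_m) :
  s \in incs m n -> I l -> {ae P, forall w,
    (\int[P]_w' (f (h (pick_tuple (pairs xi (w, w')) s I)))%:E <= 0)%E} ->
  {ae P, forall w,
    (\int[P]_w' (- f (h (pick_tuple (pairs xi (w, w')) s I)))%:E <= 0)%E} ->
  {ae P, forall w,
    (\int[P]_w' (f (h (pick_tuple (pairs xi (w, w')) s I)))%:E = 0)%E}.
Proof.
move=> sn Il le0 ge0.
have := ae_integrable1 (integrable_fh_pick I sn).
move: le0 ge0; apply: filterS3 => w le0 ge0 int.
apply/eqP; rewrite eq_le le0 /= -leeN2 oppe0.
apply: le_trans ge0; rewrite le_eqVlt; apply/orP; left; apply/eqP.
rewrite -mulN1e -EFinN -integralZl//.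
by apply: eq_integral => w' _; rewrite -EFinM mulN1r.
Qed.

End Functional.

Definition signI (I : {ffun 'I_m -> bool}) : R := \prod_k sgn R (I k).

(** When [g] is a product of functions of one coordinate, this is the product of the
    differences between their values at the variable and at its copy. *)
Definition symmetrize (g : m.-tuple S -> B) (z : nat -> S) (s : seq nat) : B :=
  \sum_I signI I *: g (pick_tuple z s I).

Lemma ae_sections : {ae P, forall w,
  forall t : nat * nat * seq nat * {ffun 'I_m -> bool},
  let: (k, n, s, J) := t in s \in incs m n ->
  P.-integrable setT
    (fun w' => (phi k (h (pick_tuple (pairs xi (w, w')) s J)))%:E) /\
  (\int[P]_w' (phi k (h (pick_tuple (pairs xi (w, w')) s J)))%:E =
   (if J == [ffun=> false] then phi k (h (seq_tuple m (xi ^~ w) s)) else 0)%:E)%E}.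
Proof.
apply: ae_forall_count => -[[[k n] s] J].
have [sn|sn] := boolP (s \in incs m n); last by apply: filterE => w.
have kdom := nphi.1 k.
have int := ae_integrable1 (integrable_fh_pick kdom J sn).
have [J0|J0] := eqVneq J [ffun=> false].
  move: int; apply: filterS => w int _; split; first exact: int.
  rewrite (eq_integral (cst (phi k (h (seq_tuple m (xi ^~ w) s)))%:E)); last first.
    move=> w' _; congr (phi k (h _))%:E; apply: eq_from_tnth => j.
    by rewrite tnth_pick_tuple_pairs tnth_mktuple J0 ffunE.
  by rewrite integral_cst// [X in (_ * X)%E](probability_setT P) mule1.
have [l Jl] : exists l, J l.
  apply/existsP; apply: contraNT J0 => /existsPn noJ; apply/eqP/ffunP => l.
  by rewrite ffunE; apply/negbTE.
have := degenerate_section_eq0 kdom sn Jl (degenerate_section_le0 kdom sn Jl)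
  (degenerate_section_le0 (dom_funN kdom) sn Jl).
move: int; apply: filterS2 => w int eq0 _; split; [exact: int|exact: eq0].
Qed.

Lemma measurable_symmetrize_sum dT (T : measurableType dT) (Z : T -> nat -> S)
    (c : seq nat -> R) (g : seq nat -> m.-tuple S -> B) r k :
  (forall j, measurable_fun setT (fun w => Z w j)) ->
  (forall s, measurable_fun setT (phi k \o g s)) ->
  measurable_fun setT
    (fun w => phi k (\sum_(s <- r) c s *: symmetrize (g s) (Z w) s)).
Proof.
move=> mZ mg; have kdom := nphi.1 k.
rewrite (_ : (fun _ => _) = fun w => \sum_(s <- r) c s *
    \sum_J signI J * phi k (g s (pick_tuple (Z w) s J))); last first.
  apply/funext => w; rewrite dom_fun_sum//; apply: eq_bigr => s _.
  rewrite dom_funZ// /symmetrize dom_fun_sum//; congr (_ * _).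
  by apply: eq_bigr => J _; rewrite dom_funZ.
apply: measurable_sum => s; apply: measurable_funM => //.
apply: measurable_sum => J; apply: measurable_funM => //.
by apply: (measurableT_comp (mg s)); apply: measurable_tuple_fun => j; exact: mZ.
Qed.

(** All terms of the symmetrized sum that use a copy integrate to zero over the
    copies, by [ae_sections].  Testing against the countable family [phi] makes the
    exceptional null set independent of the functional. *)
Lemma norm_le_integral_symmetrize : {ae P, forall w, forall n,
  ((`|\sum_(s <- incs m n) h (seq_tuple m (xi ^~ w) s)|)%:E <=
  \int[P]_w' (`|\sum_(s <- incs m n) symmetrize h (pairs xi (w, w')) s|)%:E)%E}.
Proof.
apply: filterS ae_sections => w sec n.
apply/lee_addgt0Pr => e e0.
set U := \sum_(s <- _) h _.
have [k Uk] := nphi.2 U e e0; have kdom := nphi.1 k.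
apply: (@le_trans _ _ ((phi k U)%:E + e%:E)%E); first by rewrite -EFinD lee_fin.
rewrite leeD2r//.
pose H w' := \sum_(s <- incs m n) symmetrize h (pairs xi (w, w')) s.
have mH j : measurable_fun setT (phi j \o H).
  have mS := @measurable_symmetrize_sum _ _ (pairs xi) (fun=> 1) (fun=> h)
    (incs m n) j (measurable_interleave iidxi) (fun=> measurable_fh (nphi.1 j)).
  have := measurableT_comp mS (@pair1_measurable _ _ Omega Omega w).
  apply: eq_measurable_fun => w' _ /=; congr (phi j _).
  by apply: eq_bigr => s _; rewrite scale1r.
have UH : (phi k U)%:E = (\int[P]_w' (phi k (H w'))%:E)%E.
  pose r := in_tuple (incs m n).
  have ri i : tnth r i \in incs m n by exact: mem_tnth.
  rewrite (eq_integral (fun w' => \sum_(i < size (incs m n)) \sum_J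
      ((signI J)%:E * (phi k (h (pick_tuple (pairs xi (w, w')) (tnth r i) J)))%:E))%E);
    last first.
    move=> w' _; rewrite /H dom_fun_sum// big_tnth -sumEFin; apply: eq_bigr => i _.
    rewrite /symmetrize dom_fun_sum// -sumEFin; apply: eq_bigr => J _.
    by rewrite dom_funZ.
  have int i J : P.-integrable setT (fun w' => (signI J)%:E *
      (phi k (h (pick_tuple (pairs xi (w, w')) (tnth r i) J)))%:E)%E.
    by apply: integrableZl => //; have [] := sec (k, n, tnth r i, J) (ri i).
  rewrite integral_sum//; last by move=> i; exact: integrable_sum.
  rewrite /U dom_fun_sum// big_tnth -sumEFin; apply: eq_bigr => i _.
  rewrite integral_sum//.
  transitivity (\sum_J (signI J * (if J == [ffun=> false]
      then phi k (h (seq_tuple m (xi ^~ w) (tnth r i))) else 0))%:E)%E; last first.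
    apply: eq_bigr => J _; have [intJ secJ] := sec (k, n, tnth r i, J) (ri i).
    by rewrite integralZl// secJ EFinM.
  rewrite sumEFin (bigD1 [ffun=> false])//= eqxx big1 ?addr0.
    rewrite /signI big1 ?mul1r// => l _; by rewrite ffunE /sgn expr0.
  by move=> J /negbTE ->; rewrite mulr0.
rewrite UH; apply: le_trans (lee_abs _) _.
apply: le_trans (le_abse_integral P measurableT _) _.
  by apply/measurable_EFinP; exact: mH.
apply: ge0_le_integral => //.
- by apply/measurable_EFinP; apply: measurableT_comp => //; exact: mH.
- by apply/measurable_EFinP; exact: (measurable_norming nphi).
- by move=> w' _; rewrite abse_EFin lee_fin; exact: kdom.2.
Qed.

End Degenerate.

(** * Exchanging a variable with its copy *)

(** Exchanges the entries [2 k] and [2 k + 1] for each [k] such that [e k]. *)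
Definition swap_pairs (e : nat -> bool) (k : nat) : nat :=
  ((odd k (+) e k./2) + k./2.*2)%N.

Lemma swap_pairsE e (b : bool) k :
  swap_pairs e (b + k.*2)%N = ((b (+) e k) + k.*2)%N.
Proof.
by rewrite /swap_pairs half_bit_double oddD odd_double addbF; case: b.
Qed.

Lemma swap_pairsK e : involutive (swap_pairs e).
Proof.
move=> k; rewrite -{1}(odd_double_half k) !swap_pairsE.
by rewrite addbK odd_double_half.
Qed.

Lemma sgn_addb (R : realType) b c : sgn R (b (+) c) = sgn R b * sgn R c.
Proof. by rewrite /sgn signr_addb. Qed.

(** Exchanging a variable with its copy permutes the selections [J] and changes the
    sign of each of them. *)
Lemma symmetrize_swap d (S : measurableType d) (R : realType)
    (B : normedModType R) m (g : m.-tuple S -> B) (z : nat -> S) e s :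
  size s = m ->
  symmetrize g (fun k => z (swap_pairs e k)) s = signs R e s *: symmetrize g z s.
Proof.
move=> szs; rewrite /symmetrize.
pose flip (J : {ffun 'I_m -> bool}) := [ffun k => J k (+) e (nth 0%N s k)].
have flipK : involutive flip by move=> J; apply/ffunP => k; rewrite !ffunE addbK.
rewrite (reindex_inj (inv_inj flipK)) scaler_sumr; apply: eq_bigr => J _.
rewrite scalerA; congr (_ *: g _); last first.
  apply: eq_from_tnth => k; rewrite !tnth_mktuple swap_pairsE ffunE.
  by rewrite addbK.
rewrite /signI (eq_bigr (fun k => sgn R (J k) * sgn R (e (nth 0%N s k)))); last first.
  by move=> k _; rewrite ffunE sgn_addb.
rewrite big_split mulrC /=; congr (_ * _).
by rewrite /signs (big_nth 0%N) szs big_mkord.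
Qed.

Lemma sum_powR_le (R : realType) (I : finType) (x : I -> R) q :
  (forall i, 0 <= x i) -> 0 < q ->
  (\sum_i x i) `^ q <= (#|I|%:R) `^ q * \sum_i x i `^ q.
Proof.
move=> x0 q0; have [/eqP I0|] := eqVneq #|I| 0%N.
  by rewrite !big1 => [|i|i]; rewrite ?mulr0 ?powR0 ?gt_eqF//;
     have := card0_eq (eqP I0) i; rewrite inE.
rewrite -lt0n => /card_gt0P[i0 _].
pose i := [arg max_(i > i0) x i]%O.
have xi j : x j <= x i by rewrite /i; case: arg_maxP => // k _; exact.
apply: (@le_trans _ _ ((#|I|%:R * x i) `^ q)).
  apply: ge0_ler_powR; rewrite ?nnegrE ?(ltW q0)// ?sumr_ge0//.
    by rewrite mulr_ge0.
  by rewrite mulr_natl -sumr_const; apply: ler_sum => j _.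
rewrite powRM// ler_wpM2l ?powR_ge0// (bigD1 i)//= lerDl sumr_ge0// => j _.
exact: powR_ge0.
Qed.

Lemma norm_symmetrize_le d (S : measurableType d) (R : realType)
    (B : normedModType R) m (g : m.-tuple S -> B) (z : nat -> S) s q :
  0 < q -> q <= 2 ->
  `|symmetrize g z s| `^ q <= 4 ^+ m * \sum_J `|g (pick_tuple z s J)| `^ q.
Proof.
move=> q0 q2; apply: (@le_trans _ _ ((\sum_J `|g (pick_tuple z s J)|) `^ q)).
  apply: ge0_ler_powR; rewrite ?nnegrE ?(ltW q0) ?sumr_ge0//.
  apply: le_trans (ler_norm_sum _ _ _) _; apply: ler_sum => J _.
  rewrite normrZ (_ : `|signI R J| = 1) ?mul1r//.
  rewrite /signI; elim/big_rec: _ => [|k x _ h]; first exact: normr1.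
  by rewrite normrM h mulr1 /sgn normrX normrN1 expr1n.
apply: le_trans (sum_powR_le _ q0) _ => //.
apply: ler_wpM2r; first by apply: sumr_ge0 => J _; exact: powR_ge0.
rewrite card_ffun card_bool card_ord.
apply: (@le_trans _ _ (((2 ^ m)%:R : R) `^ 2%:R)).
  by rewrite ler_powR// ler1n expn_gt0.
by rewrite powR_mulrn// natrX -exprM mulnC exprM -natrX.
Qed.

(** One sign is averaged at a time, so that only sums of two integrals occur; the
    common value may be infinite. *)
Lemma integral_avg d (T : measurableType d) (R : realType)
    (mu : {measure set T -> \bar R}) n (G : (nat -> bool) -> T -> R) (A : \bar R) :
  (forall e, measurable_fun setT (G e)) -> (forall e w, 0 <= G e w) ->
  (forall e, \int[mu]_w (G e w)%:E = A)%E ->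
  measurable_fun setT (fun w => avg n (G ^~ w)) /\
  (\int[mu]_w (avg n (G ^~ w))%:E = A)%E.
Proof.
elim: n G => [|n IHn] G mG G0 GA /=; first by split.
have A0 : (0 <= A)%E by rewrite -(GA (fun=> true)) integral_ge0// => w _; rewrite lee_fin.
have mG2 e : measurable_fun setT
    (fun w => G (update e n false) w + G (update e n true) w).
  exact: measurable_funD.
apply: (IHn (fun e w => (G (update e n false) w + G (update e n true) w) / 2)).
- by move=> e; apply: measurable_funM.
- by move=> e w; rewrite divr_ge0// addr_ge0.
move=> e; under eq_integral do rewrite mulrC EFinM.
rewrite ge0_integralZl//; last 2 first.
- by apply/measurable_EFinP; exact: mG2.
- by move=> w _; rewrite lee_fin addr_ge0.
under eq_integral do rewrite EFinD.
rewrite ge0_integralD//; last 4 first.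
- by move=> w _; rewrite lee_fin.
- by apply/measurable_EFinP; exact: mG.
- by move=> w _; rewrite lee_fin.
- by apply/measurable_EFinP; exact: mG.
rewrite !GA; case: A A0 {GA IHn} => [a a0||]//; last first.
  by move=> _; rewrite addye// gt0_muley// lte_fin invr_gt0.
by rewrite -EFinD -EFinM; congr EFin; lra.
Qed.

(** * Moments of the symmetrized sums *)

Lemma measurable_powR_comp d (T : measurableType d) (R : realType) (q : R)
    (f : T -> R) :
  measurable_fun setT f -> measurable_fun setT (fun x => f x `^ q).
Proof. by move=> mf; exact: (measurableT_comp (measurable_powR q) mf). Qed.

Lemma measurable_bigmax d (T : measurableType d) (R : realType) I (r : seq I)
    (F : I -> T -> R) :
  (forall i, measurable_fun setT (F i)) ->
  measurable_fun setT (fun x => \big[Num.max/0]_(i <- r) F i x).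
Proof.
move=> mF; elim: r => [|i r IHr].
  by under eq_fun do rewrite big_nil; exact: measurable_cst.
by under eq_fun do rewrite big_cons; apply: measurable_maxr.
Qed.

Lemma le_sum_incs (R : numDomainType) m n M (F : seq nat -> R) : (n <= M)%N ->
  (forall s, 0 <= F s) ->
  \sum_(s <- incs m.+1 n) F s <= \sum_(s <- incs m.+1 M) F s.
Proof.
move=> nM F0; rewrite !sum_incsS -(subnKC nM) big_split_ord/= lerDl.
by apply: sumr_ge0 => j _; apply: sumr_ge0.
Qed.

Lemma last_incs m n s : s \in incs m.+1 n -> (last 0%N s < n)%N.
Proof.
move=> sn; apply: (incs_lt sn); move: sn; rewrite mem_incs.
by case: s => //= x s _; exact: mem_last.
Qed.

Section Estimates.
Context d d' (Omega : measurableType d) (S : measurableType d').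
Context (R : realType) (P : probability Omega R) (xi : nat -> Omega -> S).
Context (m : nat) (B : normedModType R) (phi : nat -> B -> R).
Hypothesis iidxi : iid P xi.
Hypothesis nphi : norming phi.

Lemma integral_symmetrize_le (g : m.-tuple S -> B) (b q : R) s n :
  (forall k, measurable_fun setT (phi k \o g)) -> 0 < q -> q <= 2 -> 0 < b ->
  s \in incs m n ->
  (\int[P \x P]_w ((`|symmetrize g (pairs xi w) s| / b) `^ q)%:E <=
   (8 ^+ m)%:E * \int[P]_w ((`|g (first_tuple xi m w)| / b) `^ q)%:E)%E.
Proof.
move=> mg q0 q2 b0 sn.
have mN : measurable_fun setT (fun y => (`|g y| / b) `^ q).
  apply: measurable_powR_comp.
  by apply: measurable_funM => //; exact: (measurable_norming nphi).
have mpick (J : {ffun 'I_m -> bool}) := measurable_pick_tuple iidxi s J.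
apply: (@le_trans _ _ (\int[P \x P]_w ((4 ^+ m)%:E *
    \sum_J ((`|g (pick_tuple (pairs xi w) s J)| / b) `^ q)%:E))%E).
  apply: ge0_le_integral => //.
  - by move=> w _; rewrite lee_fin powR_ge0.
  - apply/measurable_EFinP; apply: measurable_powR_comp.
    apply: measurable_funM => //; apply: (measurable_norming nphi) => k.
    have := @measurable_symmetrize_sum _ _ _ _ _ _ nphi _ _ (pairs xi) (fun=> 1)
      (fun=> g) [:: s] k (measurable_interleave iidxi) (fun=> mg k).
    by apply: eq_measurable_fun => w _ /=; rewrite big_seq1 scale1r.
  - apply: measurable_funeM; apply: emeasurable_sum => J.
    by apply/measurable_EFinP; exact: (measurableT_comp mN (mpick J)).
  - move=> w _; rewrite sumEFin -EFinM lee_fin.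
    have bq : 0 <= (b^-1) `^ q by apply: powR_ge0.
    under eq_bigr do rewrite powRM ?invr_ge0 ?(ltW b0)//.
    rewrite powRM ?invr_ge0 ?(ltW b0)// -mulr_suml mulrA ler_wpM2r//.
    exact: norm_symmetrize_le.
rewrite ge0_integralZl//; last 2 first.
- apply: emeasurable_sum => J.
  by apply/measurable_EFinP; exact: (measurableT_comp mN (mpick J)).
- by move=> w _; apply: sume_ge0 => J _; rewrite lee_fin powR_ge0.
rewrite ge0_integral_sum//; last 2 first.
- by move=> J; apply/measurable_EFinP; exact: (measurableT_comp mN (mpick J)).
- by move=> J w _; rewrite lee_fin powR_ge0.
under eq_bigr do rewrite (first_tuple_law (F := fun y => ((`|g y| / b) `^ q)%:E) iidxi _ sn (measurableT_comp (@EFin_measurable R setT) mN)).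
set A := (\int[P]_w _)%E.
under eq_bigr do rewrite -[A]mul1e.
rewrite -ge0_sume_distrl// sumEFin sumr_const card_ffun card_bool card_ord.
by rewrite muleA -EFinM natrX -exprMn (_ : 4 * 2 = 8 :> R)//; lra.
Qed.

End Estimates.

Section MaxExcess.
Context d d' (Omega : measurableType d) (S : measurableType d').
Context (R : realType) (P : probability Omega R) (xi : nat -> Omega -> S).
Context (m : nat) (B : normedModType R) (phi : nat -> B -> R).
Hypothesis iidxi : iid P xi.
Hypothesis nphi : norming phi.
Context (g : seq nat -> m.+1.-tuple S -> B).
Hypothesis mg : forall k s, measurable_fun setT (phi k \o g s).
Context (M : nat) (b : nat -> R) (c : R).
Hypotheses (c0 : 0 < c) (b0 : forall j, 0 < b j).
Hypothesis bh : {homo b : i j / (i <= j)%N >-> i <= j}.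

Definition max_excess (z : nat -> S) : R := \big[Num.max/0]_(n < M)
  (`|\sum_(s <- incs m.+1 n.+1) symmetrize (g s) z s| / b n - c).

Lemma max_excess_ge0 z : 0 <= max_excess z.
Proof. exact: bigmax_ge_id. Qed.

Lemma measurable_norm_symmetrize dT (T : measurableType dT) (Z : T -> nat -> S) r :
  (forall j, measurable_fun setT (fun w => Z w j)) ->
  measurable_fun setT (fun w => `|\sum_(s <- r) symmetrize (g s) (Z w) s|).
Proof.
move=> mZ; apply: (measurable_norming nphi) => k.
have := @measurable_symmetrize_sum _ _ _ _ _ _ nphi _ _ Z (fun=> 1) g r k mZ (mg k).
by apply: eq_measurable_fun => w _ /=; under eq_bigr do rewrite scale1r.
Qed.

Lemma measurable_max_excess dT (T : measurableType dT) (Z : T -> nat -> S) :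
  (forall j, measurable_fun setT (fun w => Z w j)) ->
  measurable_fun setT (fun w => max_excess (Z w)).
Proof.
move=> mZ; apply: measurable_bigmax => n; apply: measurable_funB => //.
by apply: measurable_funM => //; exact: measurable_norm_symmetrize.
Qed.

(** Exchanging variables and copies according to a choice of signs does not change
    the integral and turns the symmetrized sums into a chaos; so the chaos bound
    can be applied pointwise under the average over the signs. *)
Lemma integral_max_excess_le (r C : R) : 0 < r -> r <= 2 -> 0 <= C ->
  (forall a : seq nat -> B,
    avg M (fun e => \big[Num.max/0]_(n < M) (`|chaos a m.+1 n.+1 e| / b n - c))
    <= C ^+ m.+1 * c `^ (1 - r) *
       \sum_(s <- incs m.+1 M) (`|a s| / b (last 0%N s)) `^ r) ->
  (\int[P \x P]_w (max_excess (pairs xi w))%:E <=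
   (C ^+ m.+1 * c `^ (1 - r) * 8 ^+ m.+1)%:E * \sum_(s <- incs m.+1 M)
    \int[P]_w ((`|g s (first_tuple xi m.+1 w)| / b (last 0%N s)) `^ r)%:E)%E.
Proof.
move=> r0 r2 C0 HC.
have mpairs := measurable_interleave iidxi.
pose G e w := max_excess (fun k => pairs xi w (swap_pairs e k)).
have mG e : measurable_fun setT (G e).
  by apply: measurable_max_excess => j; exact: (mpairs (swap_pairs e j)).
have G0 e w : 0 <= G e w by exact: max_excess_ge0.
have mF : measurable_fun setT (fun x : seq_space S => (max_excess x)%:E).
  apply/measurable_EFinP; apply: measurable_max_excess => j.
  exact: measurable_seq_coord.
have GA e : (\int[P \x P]_w (G e w)%:E =
             \int[P \x P]_w (max_excess (pairs xi w))%:E)%E.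
  have iI := iid_interleave iidxi.
  exact: (iid_law iI iI (fun _ _ => erefl) (inv_inj (swap_pairsK e)) mF).
have [mavg <-] := integral_avg M mG G0 GA.
have mterm s : measurable_fun setT (fun w =>
    (`|symmetrize (g s) (pairs xi w) s| / b (last 0%N s)) `^ r).
  apply: measurable_powR_comp; apply: measurable_funM => //.
  have := @measurable_norm_symmetrize _ _ (pairs xi) [:: s] mpairs.
  by apply: eq_measurable_fun => w _; rewrite big_seq1.
apply: (@le_trans _ _ (\int[P \x P]_w ((C ^+ m.+1 * c `^ (1 - r))%:E *
    \sum_(s <- incs m.+1 M)
      ((`|symmetrize (g s) (pairs xi w) s| / b (last 0%N s)) `^ r)%:E))%E).
  apply: ge0_le_integral => //.
  - by move=> w _; rewrite lee_fin avg_ge0.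
  - exact/measurable_EFinP.
  - apply: measurable_funeM; apply: emeasurable_sum => s; exact/measurable_EFinP.
  - move=> w _; rewrite sumEFin -EFinM lee_fin.
    apply: le_trans (HC (fun s => symmetrize (g s) (pairs xi w) s)).
    apply: le_avg => e; rewrite /G /max_excess le_eqVlt; apply/orP; left; apply/eqP.
    apply: eq_bigr => n _; congr (`|_| / _ - _); apply: eq_big_seq => s.
    by rewrite mem_incs => /and3P[/eqP szs _ _]; exact: symmetrize_swap.
rewrite ge0_integralZl//; last 3 first.
- by apply: emeasurable_sum => s; exact/measurable_EFinP.
- by move=> w _; apply: sume_ge0 => s _; rewrite lee_fin powR_ge0.
- by rewrite lee_fin mulr_ge0 ?exprn_ge0 ?powR_ge0.
rewrite [X in (_ <= X * _)%E]EFinM -muleA; apply: lee_wpmul2l.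
  by rewrite lee_fin mulr_ge0 ?exprn_ge0 ?powR_ge0.
rewrite ge0_integral_sum//; last 2 first.
- by move=> s; exact/measurable_EFinP.
- by move=> s w _; rewrite lee_fin powR_ge0.
rewrite ge0_sume_distrr; last by move=> s _; apply: integral_ge0 => w _; rewrite lee_fin powR_ge0.
rewrite big_seq [leRHS]big_seq; apply: lee_sum => s sM.
exact: (integral_symmetrize_le iidxi nphi _ r0 r2 (b0 _) sM).
Qed.

End MaxExcess.

(** * The probability bound for a split kernel *)

Section SplitBound.
Context d d' (Omega : measurableType d) (S : measurableType d').
Context (R : realType) (P : probability Omega R) (xi : nat -> Omega -> S).
Context (m : nat) (B : normedModType R) (phi : nat -> B -> R).
Context (h : m.+1.-tuple S -> B).
Hypothesis iidxi : iid P xi.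
Hypothesis nphi : norming phi.
Hypothesis mh : borel_measurable h.
Hypothesis deg : forall l : 'I_m.+1,
  is_cond_expectation P (sigma_of xi [set j | (j < m.+1)%N /\ j <> l])
    (fun w => h (first_tuple xi m.+1 w)) (fun=> 0).
Hypothesis inth : P.-integrable setT (fun w => (`|h (first_tuple xi m.+1 w)|)%:E).
Context (g1 g2 : seq nat -> m.+1.-tuple S -> B).
Hypothesis mg1 : forall k s, measurable_fun setT (phi k \o g1 s).
Hypothesis mg2 : forall k s, measurable_fun setT (phi k \o g2 s).
Hypothesis hE : forall s y, h y = g1 s y + g2 s y.
Context (M : nat) (b : nat -> R) (c : R).
Hypotheses (c0 : 0 < c) (b0 : forall j, 0 < b j).
Hypothesis bh : {homo b : i j / (i <= j)%N >-> i <= j}.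

Definition ustat (w : Omega) n : B :=
  \sum_(s <- incs m.+1 n) h (seq_tuple m.+1 (xi ^~ w) s).

Lemma measurable_ustat n : measurable_fun setT (fun w => `|ustat w n|).
Proof.
apply: (measurable_norming nphi) => k; have kdom := nphi.1 k.
rewrite (_ : _ \o _ = fun w =>
    \sum_(s <- incs m.+1 n) phi k (h (seq_tuple m.+1 (xi ^~ w) s))); last first.
  by apply/funext => w /=; rewrite dom_fun_sum.
apply: measurable_sum => s.
exact: (measurableT_comp (measurable_dom_fun kdom mh) (measurable_seq_tuple iidxi s)).
Qed.

(** The level is twice [c]: one half is left to the small part, the other one to
    the integral over the copies. *)
Definition exceeds (n : nat) : set Omega := [set w | 2 * c * b n < `|ustat w n.+1|].

Lemma measurable_exceeds n : measurable (exceeds n).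
Proof.
rewrite (_ : exceeds n = (fun w => `|ustat w n.+1|) @^-1` `]2 * c * b n, +oo[%classic).
  by rewrite -[X in measurable X]setTI; apply: (measurable_ustat n.+1).
by apply/seteqP; split=> w /=; rewrite in_itv/= andbT.
Qed.

(** Dominates the weighted symmetrized sums beyond the level [c]. *)
Let W (z : nat -> S) : R := max_excess g1 M b c z +
  \sum_(s <- incs m.+1 M) `|symmetrize (g2 s) z s| / b (last 0%N s).

Let W0 z : 0 <= W z.
Proof.
rewrite addr_ge0 ?max_excess_ge0// sumr_ge0// => s _.
by rewrite divr_ge0// ltW.
Qed.

Let measurable_term (g : seq nat -> m.+1.-tuple S -> B) s :
  (forall k s, measurable_fun setT (phi k \o g s)) ->
  measurable_fun setT (fun w => `|symmetrize (g s) (pairs xi w) s| / b (last 0%N s)).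
Proof.
move=> mg; apply: measurable_funM => //.
have := @measurable_norm_symmetrize _ _ _ _ _ _ nphi g mg _ _ (pairs xi) [:: s]
  (measurable_interleave iidxi).
by apply: eq_measurable_fun => w _; rewrite big_seq1.
Qed.

Let mW : measurable_fun setT (fun w => W (pairs xi w)).
Proof.
apply: measurable_funD.
  exact: (measurable_max_excess nphi mg1 _ _ _ (measurable_interleave iidxi)).
by apply: measurable_sum => s; exact: measurable_term.
Qed.

Lemma symmetrize_split s z :
  symmetrize h z s = symmetrize (g1 s) z s + symmetrize (g2 s) z s.
Proof.
rewrite /symmetrize -big_split; apply: eq_bigr => J _ /=.
by rewrite -scalerDr -hE.
Qed.

Lemma symmetrized_sum_le n z : (n < M)%N ->
  `|\sum_(s <- incs m.+1 n.+1) symmetrize h z s| <= b n * (c + W z).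
Proof.
move=> nM; rewrite (eq_bigr _ (fun s _ => symmetrize_split s z)) big_split/=.
apply: le_trans (ler_normD _ _) _; rewrite addrA mulrDr; apply: lerD.
  have : `|\sum_(s <- incs m.+1 n.+1) symmetrize (g1 s) z s| / b n - c
      <= max_excess g1 M b c z.
    exact: (@le_bigmax _ _ _ 0 (fun n : 'I_M =>
      `|\sum_(s <- incs m.+1 n.+1) symmetrize (g1 s) z s| / b n - c) (Ordinal nM)).
  by rewrite lerBlDl ler_pdivrMr// mulrC.
apply: le_trans (ler_norm_sum _ _ _) _.
apply: (@le_trans _ _ (b n * \sum_(s <- incs m.+1 n.+1)
    `|symmetrize (g2 s) z s| / b (last 0%N s))).
  rewrite mulr_sumr big_seq [leRHS]big_seq; apply: ler_sum => s sn.
  rewrite mulrCA ler_peMr// ler_pdivlMr// mul1r; apply: bh.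
  by rewrite -ltnS; exact: (@last_incs m n.+1 s sn).
rewrite ler_pM2l//; apply: le_sum_incs => // s; by rewrite divr_ge0// ltW.
Qed.

Lemma exceeds_le_integral : {ae P, forall w n, (n < M)%N -> exceeds n w ->
  (c%:E <= \int[P]_w' (W (pairs xi (w, w')))%:E)%E}.
Proof.
apply: filterS (norm_le_integral_symmetrize iidxi nphi mh deg inth) => w Uw n nM.
rewrite /exceeds /= => cU; have := Uw n.+1; rewrite -/(ustat w n.+1) => UI.
have mWw : measurable_fun setT (fun w' => (W (pairs xi (w, w')))%:E).
  apply/measurable_EFinP.
  exact: (measurableT_comp mW (@pair1_measurable _ _ Omega Omega w)).
have : (`|ustat w n.+1|%:E <=
    (b n)%:E * (c%:E + \int[P]_w' (W (pairs xi (w, w')))%:E))%E.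
  apply: le_trans UI _.
  apply: (@le_trans _ _ (\int[P]_w' ((b n)%:E * (c%:E + (W (pairs xi (w, w')))%:E)))%E).
    apply: ge0_le_integral => //.
    - apply/measurable_EFinP.
      have mS := @measurable_norm_symmetrize _ _ _ _ _ _ nphi (fun=> h)
        (fun k _ => measurable_dom_fun (nphi.1 k) mh) _ _ (pairs xi)
        (incs m.+1 n.+1) (measurable_interleave iidxi).
      exact: (measurableT_comp mS (@pair1_measurable _ _ Omega Omega w)).
    - by apply: measurable_funeM; apply: emeasurable_funD.
    - by move=> w' _; rewrite -EFinD -EFinM lee_fin symmetrized_sum_le.
  rewrite ge0_integralZl//; last 3 first.
  - exact: emeasurable_funD.
  - by move=> w' _; rewrite -EFinD lee_fin addr_ge0// ltW.
  - by rewrite lee_fin ltW.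
  rewrite ge0_integralD//; last 2 first.
  - by move=> w' _; rewrite lee_fin ltW.
  - by move=> w' _; rewrite lee_fin.
  by rewrite integral_cst// [X in (_ * (_ * X + _))%E](probability_setT P) mule1.
have : (0 <= \int[P]_w' (W (pairs xi (w, w')))%:E)%E.
  by apply: integral_ge0 => w' _; rewrite lee_fin.
case: (\int[P]_w' _)%E => [x||]//; last by move=> _ _; rewrite leey.
rewrite !lee_fin => x0 Ux.
have := b0 n; have : 2 * c * b n < b n * (c + x) by apply: lt_le_trans Ux.
move=> h1 bn; have : (2 * c - (c + x)) * b n < 0 by lra.
by rewrite pmulr_llt0//; lra.
Qed.

(** Markov's inequality for the integral of [W] over the copies, then Tonelli: the
    small part [g1] enters with the exponent [r], the large part [g2] with the
    exponent 1. *)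
Lemma prob_exceeds_le (r C : R) : 0 < r -> r <= 2 -> 1 <= C ->
  (forall a : seq nat -> B,
    avg M (fun e => \big[Num.max/0]_(n < M) (`|chaos a m.+1 n.+1 e| / b n - c))
    <= C ^+ m.+1 * c `^ (1 - r) *
       \sum_(s <- incs m.+1 M) (`|a s| / b (last 0%N s)) `^ r) ->
  (c%:E * P (\bigcup_(n < M) exceeds n) <=
   ((8 * C) ^+ m.+1)%:E * \sum_(s <- incs m.+1 M) \int[P]_w
     (c `^ (1 - r) * (`|g1 s (first_tuple xi m.+1 w)| / b (last 0%N s)) `^ r
      + `|g2 s (first_tuple xi m.+1 w)| / b (last 0%N s))%:E)%E.
Proof.
move=> r0 r2 C1 HC; set A := \bigcup_(_ < _) _.
have C0 : 0 <= C by lra.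
have mA : measurable A.
  by apply: bigcup_measurable => n _; exact: measurable_exceeds.
have mWE : measurable_fun setT (fun w => (W (pairs xi w))%:E) by apply/measurable_EFinP.
have mfirst := measurable_first_tuple (m := m.+1) iidxi.
have mnorm (g : seq nat -> m.+1.-tuple S -> B) s :
    (forall k s, measurable_fun setT (phi k \o g s)) ->
    measurable_fun setT (fun w => `|g s (first_tuple xi m.+1 w)| / b (last 0%N s)).
  move=> mg; apply: measurable_funM => //; apply: (measurable_norming nphi) => k.
  exact: (measurableT_comp (mg k s) mfirst).
apply: (@le_trans _ _ (\int[P \x P]_w (W (pairs xi w))%:E)%E).
  rewrite fubini_tonelli1//; last by move=> w; rewrite lee_fin.
  rewrite -[in leLHS](setIT A) -integral_indic// -ge0_integralZl//; last 2 first.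
  - by apply: (@measurable_EFinP _ _ _ _ _).2; exact: measurable_indic.
  - by rewrite lee_fin ltW.
  apply: ae_ge0_le_integral => //.
  - by move=> w _; rewrite -EFinM lee_fin mulr_ge0// ltW.
  - by apply: measurable_funeM; apply: (@measurable_EFinP _ _ _ _ _).2; exact: measurable_indic.
  - by move=> w _; apply: integral_ge0 => w' _; rewrite lee_fin.
  - apply: (measurable_fun_fubini_tonelli_F (m2 := P) (fun w => (W (pairs xi w))%:E)) => //.
    by move=> w; rewrite lee_fin.
  apply: filterS exceeds_le_integral => w hw _.
  rewrite indicE; have [|wA] := boolP (w \in A); last first.
    by rewrite mule0; apply: integral_ge0 => w' _; rewrite lee_fin.
  by move/set_mem => -[n /= nM wn]; rewrite mule1; exact: (hw n).
under eq_integral do rewrite EFinD.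
rewrite ge0_integralD//; last 4 first.
- by move=> w _; rewrite lee_fin max_excess_ge0.
- apply/measurable_EFinP.
  exact: (measurable_max_excess nphi mg1 _ _ _ (measurable_interleave iidxi)).
- by move=> w _; rewrite lee_fin sumr_ge0// => s _; rewrite divr_ge0// ltW.
- by apply/measurable_EFinP; apply: measurable_sum => s; exact: measurable_term.
have pw0 s w : 0 <= (`|g1 s (first_tuple xi m.+1 w)| / b (last 0%N s)) `^ r.
  exact: powR_ge0.
have n0 (g : seq nat -> m.+1.-tuple S -> B) s w :
    0 <= `|g s (first_tuple xi m.+1 w)| / b (last 0%N s).
  by rewrite divr_ge0// ltW.
have cr0 : 0 <= c `^ (1 - r) by apply: powR_ge0.
have intE s : (\int[P]_w (c `^ (1 - r) * (`|g1 s (first_tuple xi m.+1 w)| / b (last 0%N s)) `^ r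
      + `|g2 s (first_tuple xi m.+1 w)| / b (last 0%N s))%:E =
   (c `^ (1 - r))%:E * \int[P]_w ((`|g1 s (first_tuple xi m.+1 w)| / b (last 0%N s)) `^ r)%:E
   + \int[P]_w (`|g2 s (first_tuple xi m.+1 w)| / b (last 0%N s))%:E)%E.
  under eq_integral do rewrite EFinD.
  rewrite ge0_integralD//; last 4 first.
  - by move=> w _; rewrite lee_fin mulr_ge0.
  - apply/measurable_EFinP; apply: measurable_funM => //.
    by apply: measurable_powR_comp; exact: mnorm.
  - by move=> w _; rewrite lee_fin.
  - by apply/measurable_EFinP; exact: mnorm.
  congr (_ + _)%E; under eq_integral do rewrite EFinM.
  rewrite ge0_integralZl//.
    by apply/measurable_EFinP; apply: measurable_powR_comp; exact: mnorm.
  by move=> w _; rewrite lee_fin.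
under eq_bigr do rewrite intE.
rewrite big_split/= muleDr//; last first.
  apply: ge0_adde_def; rewrite inE; apply: sume_ge0 => s _.
    by rewrite mule_ge0 ?lee_fin// integral_ge0// => w _; rewrite lee_fin.
  by rewrite integral_ge0// => w _; rewrite lee_fin.
apply: leeD.
  apply: le_trans (integral_max_excess_le iidxi nphi mg1 b0 r0 r2 C0 HC) _.
  rewrite -ge0_sume_distrr; last by move=> s _; rewrite integral_ge0// => w _; rewrite lee_fin.
  by rewrite muleA -EFinM exprMn mulrAC [8 ^+ _ * _]mulrC.
under eq_integral do rewrite -sumEFin.
rewrite ge0_integral_sum//; last 2 first.
- by move=> s; apply/measurable_EFinP; exact: measurable_term.
- by move=> s w _; rewrite lee_fin divr_ge0// ltW.
rewrite ge0_sume_distrr; last by move=> s _; rewrite integral_ge0// => w _; rewrite lee_fin.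
rewrite big_seq [leRHS]big_seq; apply: lee_sum => s sM.
have r1 : (1 : R) <= 2 by rewrite ler1n.
have pr1 (x : B) : (`|x| / b (last 0%N s)) `^ 1 = `|x| / b (last 0%N s).
  by rewrite powRr1// divr_ge0// ltW.
apply: (@le_trans _ _
    (\int[P \x P]_w ((`|symmetrize (g2 s) (pairs xi w) s| / b (last 0%N s)) `^ 1)%:E)%E).
  by rewrite le_eqVlt; apply/orP; left; apply/eqP/eq_integral => w _; rewrite pr1.
apply: le_trans (integral_symmetrize_le iidxi nphi (mg2 ^~ s) ltr01 r1 (b0 _) sM) _.
under eq_integral do rewrite pr1.
apply: lee_wpmul2r.
  by rewrite integral_ge0// => w _; rewrite lee_fin.
by rewrite lee_fin exprMn ler_peMr ?exprn_ge0// exprn_ege1.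
Qed.

End SplitBound.

(** * Weighted sums of truncated powers *)

Section WeightedSums.
Context (R : realType).
Implicit Types (w : nat -> R) (x y s : R).

Lemma powR_ratio_ge_tangent x y rho : 1 < rho -> 0 < x -> 0 < y ->
  (y - x) * y `^ (- rho) <= (x `^ (1 - rho) - y `^ (1 - rho)) / (rho - 1).
Proof.
move=> rho1 x0 y0; have rho0 : 0 < rho - 1 by lra.
have z0 : 0 < x / y by apply: divr_gt0.
have := powRN_ge_tangent (ltW rho0) z0.
have -> : - (rho - 1) = 1 - rho by lra.
have -> : x `^ (1 - rho) = y `^ (1 - rho) * (x / y) `^ (1 - rho).
  by rewrite -powRM ?(ltW y0) ?(ltW z0)// mulrCA divff ?gt_eqF// mulr1.
have -> : y `^ (- rho) = y `^ (1 - rho) / y.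
  rewrite !(gt0_powRB _ _ y0) powRr1 ?(ltW y0)//.
  by rewrite -[- rho]add0r (gt0_powRB _ _ y0) powRr0 mul1r mulrAC divff ?gt_eqF// mul1r.
set a := y `^ _; set q := _ `^ _ => qz.
have a0 : 0 <= a by apply: powR_ge0.
have -> : (y - x) * (a / y) = a * (1 - x / y) by field; rewrite gt_eqF.
rewrite ler_pdivlMr// -[X in _ <= _ - X]mulr1 -mulrBr -mulrA ler_wpM2l//.
by rewrite mulrC; lra.
Qed.

Lemma powR_ratio_le_tangent x y s : 0 < s < 1 -> 0 <= x -> 0 < y ->
  (y - x) * y `^ (s - 1) <= (y `^ s - x `^ s) / s.
Proof.
move=> /andP[s0 s1] x0 y0; have z0 : 0 <= x / y by rewrite divr_ge0// ltW.
have s01 : 0 < s <= 1 by rewrite s0 ltW.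
have := powR_le_tangent s01 z0.
have -> : x `^ s = y `^ s * (x / y) `^ s.
  by rewrite -powRM ?(ltW y0)// mulrCA divff ?gt_eqF// mulr1.
rewrite (gt0_powRB _ _ y0) powRr1 ?(ltW y0)//.
set a := y `^ _; set q := _ `^ _ => qz.
have a0 : 0 <= a by apply: powR_ge0.
have -> : (y - x) * (a / y) = a * (1 - x / y) by field; rewrite gt_eqF.
rewrite ler_pdivlMr// -[X in _ <= X - _]mulr1 -mulrBr -mulrA ler_wpM2l//.
by rewrite mulrC; lra.
Qed.

(** Comparison with the integral of [y `^ (- rho)] over the half-line above 1. *)
Lemma sum_increments_above w rho n : 1 < rho -> (forall j, 0 <= w j) ->
  {homo w : i j / (i <= j)%N >-> i <= j} ->
  \sum_(j < n) (w j.+1 - w j) * (if 1 <= w j.+1 then w j.+1 `^ (- rho) else 0)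
  <= rho / (rho - 1).
Proof.
move=> rho1 w0 wh; have rho0 : 0 < rho - 1 by lra.
have rE : rho / (rho - 1) = 1 + (rho - 1)^-1 by field; rewrite gt_eqF.
suff claim : \sum_(j < n) (w j.+1 - w j) * (if 1 <= w j.+1 then w j.+1 `^ (- rho) else 0)
    <= if 1 <= w n then rho / (rho - 1) - w n `^ (1 - rho) / (rho - 1) else 0.
  apply: le_trans claim _; case: ifP => _.
    by rewrite gerBl divr_ge0 ?powR_ge0// ltW.
  by rewrite divr_ge0//; lra.
elim: n => [|n IHn].
  rewrite big_ord0; case: ifPn => // w1; rewrite -mulrBl divr_ge0//; last lra.
  rewrite subr_ge0; apply: (@le_trans _ _ (w 0%N `^ 0)); last by rewrite powRr0; lra.
  by rewrite ler_powR//; lra.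
rewrite big_ord_recr/=; have wS := wh n n.+1 (leqnSn n).
set x := w n in IHn wS *; set y := w n.+1 in wS *.
have [y1|y1] := leP 1 y; last first.
  rewrite mulr0 addr0; apply: le_trans IHn _.
  by rewrite ifF//; apply/negbTE; rewrite -ltNge; lra.
have y0 : 0 < y by lra.
have x0 : 0 <= x := w0 n.
move: IHn; have [x1|x1] := leP 1 x => IHn.
  apply: le_trans (lerD IHn (powR_ratio_ge_tangent rho1 _ y0)) _; first lra.
  by rewrite mulrBl; lra.
apply: le_trans (lerD IHn (lexx _)) _; rewrite add0r.
have yr : y `^ (1 - rho) = y * y `^ (- rho).
  by rewrite powRD ?powRr1 ?(ltW y0)//; apply/implyP => _; rewrite gt_eqF.
have yr1 : y `^ (1 - rho) <= 1.
  by rewrite -[leRHS](powRr0 y) ler_powR//; lra.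
have pos : 0 <= y `^ (- rho) by apply: powR_ge0.
apply: (@le_trans _ _ (y `^ (1 - rho))).
  by rewrite yr ler_wpM2r//; lra.
have : 0 <= (1 - y `^ (1 - rho)) / (rho - 1) by rewrite divr_ge0//; lra.
by rewrite rE mulrBl mul1r; lra.
Qed.

(** Comparison with the integral of [y `^ (s - 1)] over the unit interval. *)
Lemma sum_increments_below w s n : 0 < s < 1 -> w 0%N = 0 ->
  (forall j, 0 < w j.+1) -> {homo w : i j / (i <= j)%N >-> i <= j} ->
  \sum_(j < n) (w j.+1 - w j) * (if 1 <= w j.+1 then 0 else w j.+1 `^ (s - 1))
  <= s^-1.
Proof.
move=> s01 w00 w0 wh; have [s0 s1] := andP s01.
have pow1 x : 0 <= x -> x <= 1 -> x `^ s <= 1.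
  move=> x0 x1; have := @ge0_ler_powR _ s (ltW s0) x 1.
  by rewrite powR1; apply; rewrite ?nnegrE.
have w_ge0 j : 0 <= w j by case: j => [|j]; rewrite ?w00// ltW.
suff claim : \sum_(j < n) (w j.+1 - w j) * (if 1 <= w j.+1 then 0 else w j.+1 `^ (s - 1))
    <= (if 1 <= w n then 1 else w n `^ s) / s.
  apply: le_trans claim _; rewrite ler_pdivrMr// mulVf ?gt_eqF//.
  by case: ifPn => // wn; rewrite pow1// ltW// ltNge.
elim: n => [|n IHn].
  rewrite big_ord0 divr_ge0 ?(ltW s0)//; by case: ifP => // _; exact: powR_ge0.
rewrite big_ord_recr/=; have wS := wh n n.+1 (leqnSn n).
have [y1|y1] := leP 1 (w n.+1).
  rewrite mulr0 addr0; apply: le_trans IHn _; rewrite ler_pM2r ?invr_gt0//.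
  by case: ifPn => // wn; rewrite pow1// ltW// ltNge.
move: IHn; rewrite ifF; last by apply/negbTE; rewrite -ltNge (le_lt_trans wS).
move=> IHn; apply: le_trans (lerD IHn (powR_ratio_le_tangent s01 (w_ge0 n) (w0 n))) _.
by rewrite -mulrDl addrC subrK.
Qed.

End WeightedSums.

Lemma ffact_le_exp n k : (n ^_ k <= n ^ k)%N.
Proof.
elim: k => // k IHk; rewrite ffactnSr expnSr; apply: leq_mul => //.
exact: leq_subr.
Qed.

(** Both terms are compared with [k.+1 * n ^ k], Bernoulli's inequality giving the
    increment of the power. *)
Lemma bin_fact_le n k : ('C(n, k) * (k.+1)`! + n ^ k.+1 <= n.+1 ^ k.+1)%N.
Proof.
have bern i : (i.+1 * n ^ i + n ^ i.+1 <= n.+1 ^ i.+1)%N.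
  elim: i => [|i IHi]; first by rewrite expn0 !expn1 muln1 addnC addn1.
  rewrite [X in (_ <= X)%N]expnS; apply: leq_trans (leq_mul (leqnn n.+1) IHi).
  by rewrite (expnS n i.+1) (expnS n i); move: (n ^ i)%N => x; nia.
apply: leq_trans (bern k); rewrite leq_add2r factS mulnCA bin_ffact leq_mul2l.
by rewrite ffact_le_exp orbT.
Qed.

Lemma sum_incs_last (V : zmodType) m M (f : nat -> V) :
  \sum_(s <- incs m.+1 M) f (last 0%N s) = \sum_(j < M) f j *+ 'C(j, m).
Proof.
rewrite sum_incsS; apply: eq_bigr => j _.
under eq_bigr do rewrite last_rcons.
by rewrite big_const_seq count_predT iter_addr_0 size_incs.
Qed.

Section Truncation.
Context (R : realType) (p r : R) (m : nat).
Hypothesis p1 : 1 < p.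
Hypothesis pr : p < r.
Hypothesis r2 : r <= 2.

Let beta : R := m.+1%:R / p.

Definition truncation_constant : R := 2 * (r / p / (r / p - 1)) + (1 - p^-1)^-1.

(** With [u := (z / t) `^ p] and [w j := j ^ m.+1 / u], the truncation occurs where
    [w] crosses 1.  The number of tuples with last index [j] is at most
    [u (w j.+1 - w j) / m.+1!], so both sums are Riemann sums: of [y ^ (- r / p)]
    above 1, and of [y ^ (- 1 / p)] below 1. *)
Lemma truncation_sum_le M (t z : R) : 0 < t -> 0 <= z ->
  \sum_(s <- incs m.+1 M) ((t / 2) `^ (1 - r) *
      ((if z <= t * (last 0%N s).+1%:R `^ beta then z else 0) /
       (last 0%N s).+1%:R `^ beta) `^ r +
    (if z <= t * (last 0%N s).+1%:R `^ beta then 0 else z) /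
       (last 0%N s).+1%:R `^ beta)
  <= truncation_constant * t `^ (1 - p) * z `^ p / (m.+1)`!%:R.
Proof.
have [p1' pr' r2'] := And3 p1 pr r2.
move=> t0 z0; pose a (j : nat) : R := j.+1%:R `^ beta.
pose f j := (t / 2) `^ (1 - r) * ((if z <= t * a j then z else 0) / a j) `^ r +
  (if z <= t * a j then 0 else z) / a j.
rewrite (sum_incs_last m M f).
have p0 : 0 < p by lra.
have a0 j : 0 < a j by apply: powR_gt0.
have [z00|zn0] := eqVneq z 0.
  rewrite /f z00 powR0 ?gt_eqF// mulr0 mul0r big1// => j _.
  by rewrite !if_same mul0r powR0 ?mulr0 ?addr0 ?mul0rn// gt_eqF//; lra.
have {zn0} zp : 0 < z by rewrite lt_neqAle eq_sym zn0.
pose u := (z / t) `^ p; have u0 : 0 < u by rewrite powR_gt0 ?divr_gt0.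
pose w (j : nat) : R := j%:R ^+ m.+1 / u.
have ap j : a j `^ p = j.+1%:R ^+ m.+1.
  by rewrite /a -powRrM /beta divfK ?gt_eqF// powR_mulrn.
pose q j := t * a j / z.
have q0 j : 0 < q j by rewrite divr_gt0// mulr_gt0.
have uV : (t / z) `^ p = u^-1.
  apply: (mulfI (lt0r_neq0 u0)); rewrite mulfV ?gt_eqF// /u -powRM ?divr_ge0 ?(ltW t0)//.
  by rewrite mulrA divfK ?gt_eqF// divff ?gt_eqF// powR1.
have wq j : w j.+1 = q j `^ p.
  have -> : q j = a j * (t / z) by rewrite /q; ring.
  by rewrite powRM ?(ltW (a0 j)) ?divr_ge0 ?(ltW t0)// uV ap.
have qge1 j : (1 <= q j) = (z <= t * a j) by rewrite /q ler_pdivlMr// mul1r.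
have wge1 j : (1 <= w j.+1) = (z <= t * a j).
  have one : 1 = 1 `^ p :> R by rewrite powR1.
  rewrite -qge1 wq [X in X <= _ `^ p]one; have [h|h] := leP 1 (q j).
    by apply: ge0_ler_powR; rewrite ?nnegrE ?(ltW p0) ?ler01// ltW.
  apply/negbTE; rewrite -ltNge.
  by apply: gt0_ltr_powR; rewrite ?nnegrE ?ler01// ltW.
have fle j : f j <= t * (2 * (if 1 <= w j.+1 then w j.+1 `^ (- (r / p)) else 0) +
    (if 1 <= w j.+1 then 0 else w j.+1 `^ ((1 - p^-1) - 1))).
  have za : z / a j = t / q j by rewrite /q; field; rewrite !gt_eqF.
  rewrite /f wge1; case: ifP => _.
    rewrite mul0r !addr0.
    have -> : (z / a j) `^ r = t `^ r * (q j)^-1 `^ r.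
      by rewrite za powRM ?invr_ge0 ?(ltW (q0 j)) ?(ltW t0).
    have -> : w j.+1 `^ (- (r / p)) = (q j)^-1 `^ r.
      rewrite wq -powRrM mulrN mulrCA divff ?gt_eqF// mulr1 -mulN1r powRrM.
      by rewrite powR_inv1// ltW.
    set x := _^-1 `^ r; have x0 : 0 <= x by apply: powR_ge0.
    rewrite mulrA [leRHS]mulrA ler_wpM2r//.
    have t2 : 0 < t / 2 by rewrite divr_gt0.
    rewrite (gt0_powRB _ _ t2) powRr1 ?(ltW t2)//.
    have -> : t `^ r = (t / 2) `^ r * 2 `^ r.
      by rewrite -powRM ?(ltW t2)// divfK.
    rewrite mulrA divfK; last by rewrite gt_eqF// powR_gt0.
    have : 2 `^ r <= 2 `^ 2%:R :> R by rewrite ler_powR// ler1n.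
    by rewrite powR_mulrn// => h; nra.
  rewrite mul0r powR0; last by rewrite gt_eqF//; lra.
  rewrite !mulr0 !add0r.
  rewrite za (_ : 1 - p^-1 - 1 = - p^-1); last by ring.
  rewrite wq -powRrM mulrN divff ?gt_eqF// powR_inv1//; exact: ltW.
have wh : {homo w : i j / (i <= j)%N >-> i <= j}.
  move=> i j ij; rewrite /w ler_wpM2r ?invr_ge0 ?(ltW u0)//.
  by rewrite -!natrX ler_nat leq_exp2r.
have w00 : w 0%N = 0 by rewrite /w expr0n mul0r.
have wpos j : 0 < w j.+1 by rewrite wq powR_gt0.
have w_ge0 j : 0 <= w j by rewrite /w divr_ge0 ?exprn_ge0 ?(ltW u0).
have rp1 : 1 < r / p by rewrite ltr_pdivlMr// mul1r.
have s01 : 0 < 1 - p^-1 < 1.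
  by rewrite subr_gt0 gtrBl invr_gt0 p0 andbT invf_lt1.
have S1 := sum_increments_above M rp1 w_ge0 wh.
have S2 := sum_increments_below M s01 w00 wpos wh.
have fact0 : 0 < (m.+1)`!%:R :> R by rewrite ltr0n fact_gt0.
have bw j : 'C(j, m)%:R <= u / (m.+1)`!%:R * (w j.+1 - w j).
  have := bin_fact_le j m; rewrite -(ler_nat R) natrD natrM !natrX => h.
  have -> : u / (m.+1)`!%:R * (w j.+1 - w j) =
      (j.+1%:R ^+ m.+1 - j%:R ^+ m.+1) / (m.+1)`!%:R.
    by rewrite /w; field; rewrite !gt_eqF.
  by rewrite ler_pdivlMr// lerBrDr.
apply: (@le_trans _ _ (\sum_(j < M) u / (m.+1)`!%:R * t *
  (2 * ((w j.+1 - w j) * (if 1 <= w j.+1 then w j.+1 `^ (- (r / p)) else 0)) +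
    (w j.+1 - w j) * (if 1 <= w j.+1 then 0 else w j.+1 `^ ((1 - p^-1) - 1))))).
  apply: ler_sum => j _; rewrite -[leLHS]mulr_natl.
  have f0 : 0 <= f j.
    apply: addr_ge0; first by rewrite mulr_ge0 ?powR_ge0.
    by apply: divr_ge0; [case: ifP|exact: ltW].
  apply: le_trans (ler_wpM2r f0 (bw j)) _.
  have uw0 : 0 <= u / (m.+1)`!%:R * (w j.+1 - w j).
    by rewrite mulr_ge0 ?divr_ge0 ?(ltW u0) ?(ltW fact0)// subr_ge0 wh.
  apply: le_trans (ler_wpM2l uw0 (fle j)) _.
  by rewrite le_eqVlt; apply/orP; left; apply/eqP; ring.
rewrite -mulr_sumr big_split/= -mulr_sumr.
set X1 := \sum_(_ < _) _ in S1 *; set X2 := \sum_(_ < _) _ in S2 *.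
have ut : t * u = t `^ (1 - p) * z `^ p.
  rewrite (gt0_powRB _ _ t0) powRr1 ?(ltW t0)// /u powRM ?invr_ge0 ?(ltW zp) ?(ltW t0)//.
  have -> : t^-1 `^ p = (t `^ p)^-1 by rewrite -powR_inv1 ?(ltW t0)// powRAC powR_inv1// powR_ge0.
  by ring.
rewrite -[leRHS]mulrA -[leRHS]mulrA [t `^ _ * _]mulrA -ut.
have -> : u / (m.+1)`!%:R * t * (2 * X1 + X2) = (2 * X1 + X2) * (t * u / (m.+1)`!%:R) by ring.
rewrite ler_wpM2r//; first by rewrite divr_ge0 ?mulr_ge0 ?(ltW t0) ?(ltW u0) ?(ltW fact0).
by rewrite /truncation_constant; lra.
Qed.

End Truncation.

(** The tail of the series is small whatever the factors are, and the factors are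
    small on the remaining finite set of indices. *)
Lemma damped_sum_small (R : realType) (a : nat -> R) (q : nat -> nat -> R) (A e : R) :
  0 < e -> (forall j, 0 <= a j) -> (forall M, \sum_(j < M) a j <= A) ->
  (forall N j, 0 <= q N j <= 1) ->
  (forall J d, 0 < d -> exists N, forall j, (j < J)%N -> q N j <= d) ->
  exists N, forall M, \sum_(j < M) q N j * a j <= e.
Proof.
move=> e0 a0 aA q01 qsmall; pose S M := \sum_(j < M) a j.
have supS : has_sup (range S).
  split; first by exists (S 0%N), 0%N.
  by exists A => _ [M _ <-]; exact: aA.
have e2 : 0 < e / 2 by rewrite divr_gt0.
have [_ [J _ <-] SJ] := sup_adherent e2 supS.
have tail M : S M <= S J + e / 2.
  have : S M <= sup (range S) by apply: sup_upper_bound => //; exists M.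
  by lra.
have A0 : 0 <= A by have := aA 0%N; rewrite big_ord0.
have [N qN] := qsmall J (e / 2 / (A + 1)) (divr_gt0 e2 (ltr_wpDl A0 ltr01)).
exists N => M; have Smono : S M <= S (maxn M J).
  have MM : (M <= maxn M J)%N := leq_maxl _ _.
  rewrite /S -(subnKC MM) big_split_ord/= lerDl; exact: sumr_ge0.
have le1 : \sum_(j < M) q N j * a j <= \sum_(j < maxn M J) q N j * a j.
  have MM : (M <= maxn M J)%N := leq_maxl _ _.
  rewrite -(subnKC MM) big_split_ord/= lerDl; apply: sumr_ge0 => j _.
  by rewrite mulr_ge0//; case/andP: (q01 N (M + j)%N).
apply: le_trans le1 _.
have JM : (J <= maxn M J)%N := leq_maxr _ _.
have := tail (maxn M J); rewrite /S -(subnKC JM) !big_split_ord/= -/(S J).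
move=> tl.
have h1 : \sum_(j < J) q N j * a j <= e / 2.
  apply: (@le_trans _ _ (e / 2 / (A + 1) * S J)).
    rewrite /S mulr_sumr; apply: ler_sum => j _; rewrite ler_wpM2r//; exact: qN.
  have SA : S J <= A := aA J.
  rewrite mulrAC ler_pdivrMr; last lra.
  by rewrite ler_pM2l//; lra.
set X := \sum_(i < _) a _ in tl.
have h2 : \sum_(i < maxn M J - J) q N (J + i)%N * a (J + i)%N <= X.
  by apply: ler_sum => j _; rewrite ler_piMl//; case/andP: (q01 N (J + j)%N).
by lra.
Qed.

(** * The weak type bound and the almost sure convergence *)

Lemma truncation_constant_gt0 (R : realType) (p r : R) : 1 < p -> p < r ->
  0 < truncation_constant p r.
Proof.
move=> p1 pr; have p0 : 0 < p by lra.
have rp1 : 1 < r / p by rewrite ltr_pdivlMr// mul1r.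
have ip : p^-1 < 1 by rewrite invf_lt1.
by rewrite /truncation_constant addr_gt0 ?mulr_gt0 ?divr_gt0 ?invr_gt0//; lra.
Qed.

(** Increasing tuples of ordinals and increasing sequences of naturals correspond. *)
Lemma Usum_incs d (S : measurableType d) (V : nmodType) m (h : m.-tuple S -> V)
    (x : nat -> S) n :
  Usum h x n = \sum_(s <- incs m n) h (seq_tuple m x s).
Proof.
rewrite /Usum (eq_bigr (fun i : m.-tuple 'I_n => h (seq_tuple m x (map val i)))).
  rewrite -big_enum -(big_map (fun i : m.-tuple 'I_n => map val i) predT
    (fun s => h (seq_tuple m x s))); apply: perm_big.
  apply: uniq_perm; rewrite ?incs_uniq//.
    by rewrite map_inj_uniq ?enum_uniq// => i j /(inj_map val_inj)/val_inj.
  move=> s; rewrite mem_incs; apply/mapP/and3P => [[i]|[/eqP szs sorts alls]].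
    rewrite mem_enum inE => sorti ->; split => //.
      by rewrite size_map size_tuple.
    by apply/allP => _ /mapP[k _ ->] /=; exact: ltn_ord.
  have vs : map val (pmap (insub : nat -> option 'I_n) s) = s.
    rewrite (pmap_filter (insubK _)); apply/all_filterP; apply: sub_all alls.
    by move=> k /= kn; rewrite insubT.
  have szt : size (pmap (insub : nat -> option 'I_n) s) == m.
    by rewrite -(size_map val) vs szs.
  by exists (Tuple szt); rewrite ?mem_enum ?inE /= vs.
move=> i _; congr h; apply: eq_from_tnth => k; rewrite !tnth_mktuple.
by rewrite (nth_map (tnth_default i k)) ?size_tuple.
Qed.

Lemma measure_bigcup_le d (T : measurableType d) (R : realType)
    (mu : {measure set T -> \bar R}) (F : nat -> set T) (x : \bar R) :
  (forall n, measurable (F n)) ->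
  (forall M, (mu (\bigcup_(n < M) F n) <= x)%E) -> (mu (\bigcup_n F n) <= x)%E.
Proof.
move=> mF Fx; pose G M := \bigcup_(n < M) F n.
have mG M : measurable (G M) by apply: bigcup_measurable => n _; exact: mF.
have -> : \bigcup_n F n = \bigcup_M G M.
  apply/seteqP; split=> [w [n _ Fw]|w [M _ [n nM Fw]]]; last by exists n.
  by exists n.+1 => //; exists n => /=.
have ndG : nondecreasing_seq G.
  move=> M M' MM'; apply/subsetPset => w [n nM Fw]; exists n => //.
  exact: leq_trans nM MM'.
have := nondecreasing_cvg_mu (mu := mu) mG (bigcupT_measurable G mG) ndG.
move=> cvgG; rewrite -(cvg_lim _ cvgG)//; apply: lime_le.
  by apply/cvg_ex; eexists; exact: cvgG.
by apply: nearW => M; exact: Fx.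
Qed.

Section Bounds.
Context (R : realType) (B : completeNormedModType R) (p r C : R).
Context (m : nat) (d d' : measure_display) (Omega : measurableType d)
  (S : measurableType d') (P : probability Omega R) (xi : nat -> Omega -> S)
  (h : m.+1.-tuple S -> B) (phi : nat -> B -> R).
Hypothesis p1 : 1 < p.
Hypothesis pr : p < r.
Hypothesis r2 : r <= 2.
Hypothesis C1 : 1 <= C.
Hypothesis HC : forall m M (a : seq nat -> B) (b : nat -> R) (c : R),
  0 < c -> (forall j, 0 < b j) -> {homo b : i j / (i <= j)%N >-> i <= j} ->
  avg M (fun e => \big[Num.max/0]_(n < M) (`|chaos a m.+1 n.+1 e| / b n - c))
  <= C ^+ m.+1 * c `^ (1 - r) *
     \sum_(s <- incs m.+1 M) (`|a s| / b (last 0%N s)) `^ r.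
Hypothesis nphi : norming phi.
Hypothesis iidxi : iid P xi.
Hypothesis mh : borel_measurable h.
Hypothesis deg : forall l : 'I_m.+1,
  is_cond_expectation P (sigma_of xi [set j | (j < m.+1)%N /\ j <> l])
    (fun w => h (first_tuple xi m.+1 w)) (fun=> 0).
Context (e : R).
Hypothesis momh :
  (\int[P]_w (`|h (first_tuple xi m.+1 w)| `^ p)%:E)%E = e%:E.

Let beta : R := m.+1%:R / p.

Let p0 : 0 < p. Proof. by have := p1; lra. Qed.
Let r0 : 0 < r. Proof. by have := p1; have := pr; lra. Qed.
Let beta0 : 0 < beta. Proof. by rewrite divr_gt0. Qed.

(** Constant up to index [N]; [N = 0] gives the weights of the theorem. *)
Definition weight (N j : nat) : R := (maxn N j.+1)%:R `^ beta.

Lemma weight_gt0 N j : 0 < weight N j.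
Proof. by rewrite powR_gt0// ltr0n leq_max orbT. Qed.

Lemma weight_homo N : {homo weight N : i j / (i <= j)%N >-> i <= j}.
Proof.
move=> i j ij; apply: ge0_ler_powR; rewrite ?nnegrE ?ler0n ?(ltW beta0)//.
by rewrite ler_nat geq_max leq_maxl leq_max ltnS ij orbT.
Qed.

Lemma weight0 j : weight 0 j = j.+1%:R `^ beta.
Proof. by rewrite /weight max0n. Qed.

Definition low (t : R) (s : seq nat) (y : m.+1.-tuple S) : B :=
  if `|h y| <= t * (last 0%N s).+1%:R `^ beta then h y else 0.

Definition high (t : R) (s : seq nat) (y : m.+1.-tuple S) : B :=
  if `|h y| <= t * (last 0%N s).+1%:R `^ beta then 0 else h y.

Lemma measurable_normh : measurable_fun setT (fun y => `|h y|).
Proof.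
by apply: (measurable_norming nphi) => k; exact: measurable_dom_fun (nphi.1 k) mh.
Qed.

Let mtrunc c : measurable_fun setT (fun y => `|h y| <= c).
Proof. by apply: measurable_fun_ler => //; exact: measurable_normh. Qed.

Lemma measurable_low t k s : measurable_fun setT (phi k \o low t s).
Proof.
have kdom := nphi.1 k.
rewrite (_ : _ \o _ = fun y =>
    if `|h y| <= t * (last 0%N s).+1%:R `^ beta then phi k (h y) else 0).
  by apply: measurable_fun_ifT => //; exact: measurable_dom_fun.
by apply/funext => y /=; rewrite /low; case: ifP => // _; rewrite dom_fun0.
Qed.

Lemma measurable_high t k s : measurable_fun setT (phi k \o high t s).
Proof.
have kdom := nphi.1 k.
rewrite (_ : _ \o _ = fun y =>
    if `|h y| <= t * (last 0%N s).+1%:R `^ beta then 0 else phi k (h y)).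
  by apply: measurable_fun_ifT => //; exact: measurable_dom_fun.
by apply/funext => y /=; rewrite /high; case: ifP => // _; rewrite dom_fun0.
Qed.

Lemma low_high t s y : h y = low t s y + high t s y.
Proof. by rewrite /low /high; case: ifP; rewrite ?addr0 ?add0r. Qed.

(** The contribution of the index sequence [s] to the bound [prob_exceeds_le]. *)
Definition cost (t : R) (N : nat) (s : seq nat) (y : m.+1.-tuple S) : R :=
  (t / 2) `^ (1 - r) * (`|low t s y| / weight N (last 0%N s)) `^ r +
  `|high t s y| / weight N (last 0%N s).

Lemma cost_ge0 t N s y : 0 <= cost t N s y.
Proof.
apply: addr_ge0; first by rewrite mulr_ge0 ?powR_ge0.
by rewrite divr_ge0// ltW// weight_gt0.
Qed.

Lemma measurable_cost t N s :
  measurable_fun setT (fun w => cost t N s (first_tuple xi m.+1 w)).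
Proof.
have mf := measurable_first_tuple (m := m.+1) iidxi.
have mcost : measurable_fun setT (cost t N s).
  apply: measurable_funD; last first.
    apply: measurable_funM => //.
    by apply: (measurable_norming nphi) => k; exact: measurable_high.
  apply: measurable_funM => //; apply: measurable_powR_comp.
  apply: measurable_funM => //.
  by apply: (measurable_norming nphi) => k; exact: measurable_low.
exact: (measurableT_comp mcost mf).
Qed.

Lemma integrable_normh :
  P.-integrable setT (fun w => (`|h (first_tuple xi m.+1 w)|)%:E).
Proof.
have mf := measurable_first_tuple (m := m.+1) iidxi.
have mhf := measurableT_comp measurable_normh mf.
have intp : P.-integrable setT (fun w => (`|h (first_tuple xi m.+1 w)| `^ p)%:E).
  apply/integrableP; split.
    by apply/measurable_EFinP; exact: measurable_powR_comp.
  under eq_integral do rewrite gee0_abs ?lee_fin ?powR_ge0//.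
  by rewrite momh ltry.
have int1 : P.-integrable setT (cst 1%E) by exact: finite_measure_integrable_cst.
apply: (le_integrable measurableT _ _ (integrableD measurableT int1 intp)).
  exact/measurable_EFinP.
move=> w _; rewrite /= lee_fin normr_id.
set z := `|h _|; have z0 : 0 <= z by rewrite /z.
have zp : 0 <= z `^ p by apply: powR_ge0.
rewrite ger0_norm; last lra.
have [z1|z1] := leP z 1; first lra.
apply: (@le_trans _ _ (z `^ p)); last lra.
by apply: le1r_powR; rewrite ltW.
Qed.

Definition exceed (t : R) (N n : nat) : set Omega :=
  exceeds xi h (weight N) (t / 2) n.

Lemma measurable_exceed t N n : measurable (exceed t N n).
Proof. exact: (measurable_exceeds iidxi nphi mh). Qed.

Lemma prob_exceed_le t N M : 0 < t ->
  ((t / 2)%:E * P (\bigcup_(n < M) exceed t N n) <=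
   ((8 * C) ^+ m.+1)%:E * \sum_(s <- incs m.+1 M)
     \int[P]_w (cost t N s (first_tuple xi m.+1 w))%:E)%E.
Proof.
move=> t0; have c0 : 0 < t / 2 by rewrite divr_gt0.
exact: (prob_exceeds_le iidxi nphi mh deg integrable_normh
  (measurable_low t) (measurable_high t) (low_high t) c0 (weight_gt0 N)
  (@weight_homo N) r0 r2 C1 (fun a => HC m M a c0 (weight_gt0 N) (@weight_homo N))).
Qed.

Let kap := truncation_constant p r.

Lemma sum_cost0_le t M : 0 < t ->
  (\sum_(s <- incs m.+1 M) \int[P]_w (cost t 0 s (first_tuple xi m.+1 w))%:E <=
   (kap * t `^ (1 - p) / (m.+1)`!%:R * e)%:E)%E.
Proof.
move=> t0; rewrite -ge0_integral_sum//; last 2 first.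
- by move=> s; apply/measurable_EFinP; exact: measurable_cost.
- by move=> s w _; rewrite lee_fin cost_ge0.
have mf := measurable_first_tuple (m := m.+1) iidxi.
have mhp : measurable_fun setT (fun w => `|h (first_tuple xi m.+1 w)| `^ p).
  apply: measurable_powR_comp; exact: (measurableT_comp measurable_normh mf).
have k0 : 0 <= kap * t `^ (1 - p) / (m.+1)`!%:R.
  by rewrite divr_ge0// mulr_ge0 ?powR_ge0// ltW// (truncation_constant_gt0 p1 pr).
rewrite EFinM -momh -ge0_integralZl//; last exact/measurable_EFinP.
apply: ge0_le_integral => //.
- by move=> w _; apply: sume_ge0 => s _; rewrite lee_fin cost_ge0.
- apply: emeasurable_sum => s; apply/measurable_EFinP; exact: measurable_cost.
- by apply: measurable_funeM; apply/measurable_EFinP.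
move=> w _; rewrite sumEFin -EFinM lee_fin.
set y := first_tuple _ _ _.
have := truncation_sum_le m p1 pr r2 M t0 (normr_ge0 (h y)).
rewrite -/beta -/kap [leRHS]mulrAC; apply: le_trans.
rewrite le_eqVlt; apply/orP; left; apply/eqP; apply: eq_bigr => s _.
by rewrite /cost weight0 /low /high; case: ifP; rewrite ?normr0.
Qed.

Lemma moment_ge0 : 0 <= e.
Proof. by rewrite -lee_fin -momh integral_ge0// => w _; rewrite lee_fin powR_ge0. Qed.

(** The factorial beats the geometric growth of the constants: this makes the
    final constant independent of [m]. *)
Lemma prob_sup_le t : 0 < t ->
  ((t `^ p)%:E * P (\bigcup_n exceed t 0 n) <=
   (2 * kap * expR (8 * C) * e)%:E)%E.
Proof.
move=> t0; have C1' := C1; have e0 := moment_ge0.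
have kap0 : 0 < kap := truncation_constant_gt0 p1 pr.
have tp0 : 0 < t `^ p by apply: powR_gt0.
suff Pu : (P (\bigcup_n exceed t 0 n) <=
    ((t `^ p)^-1 * (2 * kap * expR (8 * C) * e))%:E)%E.
  apply: le_trans (lee_wpmul2l _ Pu) _; first by rewrite lee_fin ltW.
  by rewrite -EFinM mulrA divff ?gt_eqF// mul1r.
apply: measure_bigcup_le => [n|M]; first exact: measurable_exceed.
set A := \bigcup_(_ < _) _.
have mA : measurable A by apply: bigcup_measurable => n _; exact: measurable_exceed.
have PA : P A = (fine (P A))%:E by rewrite fineK// fin_num_measure.
apply: (@le_trans _ _ (fine (P A))%:E); first by rewrite -PA.
have D0 : 0 <= (8 * C) ^+ m.+1 by rewrite exprn_ge0//; lra.
have := prob_exceed_le 0 M t0; rewrite -/A => h1.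
have h2 : (((8 * C) ^+ m.+1)%:E * \sum_(s <- incs m.+1 M)
     \int[P]_w (cost t 0 s (first_tuple xi m.+1 w))%:E <=
     ((8 * C) ^+ m.+1)%:E * (kap * t `^ (1 - p) / (m.+1)`!%:R * e)%:E)%E.
  by apply: lee_wpmul2l; [rewrite lee_fin|exact: sum_cost0_le].
have := le_trans h1 h2; rewrite PA -!EFinM !lee_fin.
set x := fine _; rewrite (gt0_powRB _ _ t0) powRr1 ?(ltW t0)// => hx.
have fact0 : 0 < (m.+1)`!%:R :> R by rewrite ltr0n fact_gt0.
have expD : (8 * C) ^+ m.+1 / (m.+1)`!%:R <= expR (8 * C).
  have := @expR_ge1Dxn R (8 * C) m; have D8 : 0 <= 8 * C by lra.
  by move=> /(_ D8); lra.
rewrite [leRHS]mulrC ler_pdivlMr// -(ler_pM2l (_ : 0 < t / 2)) ?divr_gt0// mulrA.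
apply: le_trans (ler_wpM2r (ltW tp0) hx) _.
rewrite (_ : _ * _ * t `^ p = t * kap * e * ((8 * C) ^+ m.+1 / (m.+1)`!%:R)); last first.
  by field; rewrite !gt_eqF.
rewrite (_ : t / 2 * _ = t * kap * e * expR (8 * C)); last by field.
by rewrite ler_wpM2l// !mulr_ge0// ltW.
Qed.

Lemma cost_damped t N s y :
  cost t N s y <= weight 0 (last 0%N s) / weight N (last 0%N s) * cost t 0 s y.
Proof.
set j := last 0%N s; have w0 := weight_gt0 0 j; have wN := weight_gt0 N j.
have le0N : weight 0 j <= weight N j.
  apply: ge0_ler_powR; rewrite ?nnegrE ?ler0n ?(ltW beta0)//.
  by rewrite ler_nat max0n leq_maxr.
set q := weight 0 j / weight N j.
have q0 : 0 < q by apply: divr_gt0.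
have q1 : q <= 1 by rewrite ler_pdivrMr// mul1r.
have E x : x / weight N j = q * (x / weight 0 j).
  by rewrite /q; field; rewrite !gt_eqF.
rewrite /cost -/j !E mulrDr lerD2r [leRHS]mulrCA ler_wpM2l ?powR_ge0//.
rewrite powRM ?(ltW q0)//; last by rewrite divr_ge0// ltW.
rewrite ler_wpM2r ?powR_ge0//; apply: ge1r_powR; first by rewrite q0.
by have := p1; have := pr; lra.
Qed.

(** The costs for [N = 0] are summable by [sum_cost0_le], and [cost_damped] multiplies
    them by [weight 0 j / weight N j], which is small for [j] well below [N]. *)
Lemma prob_tail_small t e' : 0 < t -> 0 < e' ->
  exists N, (P (\bigcup_n exceed t N n) <= e'%:E)%E.
Proof.
move=> t0 e'0; have C1' := C1; have e0 := moment_ge0.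
have mcost N s : measurable_fun setT (fun w => (cost t N s (first_tuple xi m.+1 w))%:E).
  by apply/measurable_EFinP; exact: measurable_cost.
have int0 N s : (0 <= \int[P]_w (cost t N s (first_tuple xi m.+1 w))%:E)%E.
  by apply: integral_ge0 => w _; rewrite lee_fin cost_ge0.
pose A := kap * t `^ (1 - p) / (m.+1)`!%:R * e.
pose I s := (\int[P]_w (cost t 0 s (first_tuple xi m.+1 w))%:E)%E.
have Ifin s M : s \in incs m.+1 M -> I s \is a fin_num.
  move=> sM; rewrite ge0_fin_numE ?int0//.
  apply: le_lt_trans (ltry A); apply: le_trans (sum_cost0_le M t0).
  rewrite (big_rem s)//= leeDl//; apply: sume_ge0 => s' _; exact: int0.
pose a j := \sum_(s <- incs m j) fine (I (rcons s j)).
have a0 j : 0 <= a j by apply: sumr_ge0 => s _; apply: fine_ge0; exact: int0.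
have aE M : ((\sum_(j < M) a j)%:E = \sum_(s <- incs m.+1 M) I s)%E.
  rewrite /a -(sum_incsS _ _ (fun s => fine (I s))) -sumEFin.
  by apply: eq_big_seq => s sM; rewrite fineK// (Ifin _ M).
have aA M : \sum_(j < M) a j <= A.
  by rewrite -lee_fin aE; exact: sum_cost0_le.
pose q N j := weight 0 j / weight N j.
have q01 N j : 0 <= q N j <= 1.
  rewrite divr_ge0 ?(ltW (weight_gt0 _ _))//= ler_pdivrMr ?weight_gt0// mul1r.
  apply: ge0_ler_powR; rewrite ?nnegrE ?ler0n ?(ltW beta0)//.
  by rewrite ler_nat max0n leq_maxr.
have beta_ge (x : R) : 0 < x -> exists N : nat, x <= N%:R `^ beta.
  move=> x0; exists (Num.bound (x `^ beta^-1)).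
  have hb : x `^ beta^-1 <= (Num.bound (x `^ beta^-1))%:R.
    by apply: ltW; apply: archi_boundP; exact: powR_ge0.
  have {1}-> : x = (x `^ beta^-1) `^ beta.
    by rewrite -powRrM mulVf ?gt_eqF// powRr1// ltW.
  by apply: ge0_ler_powR; rewrite ?nnegrE ?powR_ge0 ?ler0n ?(ltW beta0).
have qsmall J dl : 0 < dl -> exists N, forall j, (j < J)%N -> q N j <= dl.
  move=> dl0; have [N hN] := beta_ge (weight 0 J / dl) (divr_gt0 (weight_gt0 _ _) dl0).
  exists N => j jJ; rewrite /q ler_pdivrMr ?weight_gt0//.
  apply: le_trans (weight_homo 0 (ltnW jJ)) _.
  rewrite mulrC -ler_pdivrMr//; apply: le_trans hN _.
  apply: ge0_ler_powR; rewrite ?nnegrE ?ler0n ?(ltW beta0)//.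
  by rewrite ler_nat leq_maxl.
have D0 : 0 < (8 * C) ^+ m.+1 by rewrite exprn_gt0//; lra.
pose e2 := t / 2 * e' / (8 * C) ^+ m.+1.
have e20 : 0 < e2 by rewrite divr_gt0// mulr_gt0// divr_gt0.
have [N hN] := damped_sum_small e20 a0 aA q01 qsmall.
exists N; apply: measure_bigcup_le => [n|M]; first exact: measurable_exceed.
set F := \bigcup_(_ < _) _.
have mF : measurable F by apply: bigcup_measurable => n _; exact: measurable_exceed.
have PF : P F = (fine (P F))%:E by rewrite fineK// fin_num_measure.
apply: (@le_trans _ _ (fine (P F))%:E); first by rewrite -PF.
have sumN : (\sum_(s <- incs m.+1 M)
    \int[P]_w (cost t N s (first_tuple xi m.+1 w))%:E <= e2%:E)%E.
  apply: (@le_trans _ _ (\sum_(j < M) q N j * a j)%:E); last by rewrite lee_fin.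
  have -> : \sum_(j < M) q N j * a j =
      \sum_(s <- incs m.+1 M) q N (last 0%N s) * fine (I s).
    rewrite sum_incsS; apply: eq_bigr => j _; rewrite mulr_sumr.
    by apply: eq_bigr => s _; rewrite last_rcons.
  rewrite -sumEFin big_seq [leRHS]big_seq; apply: lee_sum => s sM.
  rewrite EFinM fineK ?(Ifin _ M)// /I -ge0_integralZl//; last 2 first.
  - by move=> w _; rewrite lee_fin cost_ge0.
  - by rewrite lee_fin; case/andP: (q01 N (last 0%N s)).
  apply: ge0_le_integral => //.
  - by move=> w _; rewrite lee_fin cost_ge0.
  - exact: measurable_funeM.
  - by move=> w _; rewrite -EFinM lee_fin cost_damped.
have := prob_exceed_le N M t0; rewrite -/F => h1.
have h2 := lee_wpmul2l (ltW D0 : (0 <= ((8 * C) ^+ m.+1)%:E)%E) sumN.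
have := le_trans h1 h2; rewrite PF -!EFinM !lee_fin /e2.
rewrite [leRHS]mulrC divfK ?gt_eqF// ler_pM2l// divr_gt0//.
Qed.

Lemma ae_cvg_ustat : {ae P, forall w,
  `|ustat xi h w n| / n%:R `^ beta @[n --> \oo] --> (0 : R)}.
Proof.
pose T (k : nat) : R := k.+1%:R^-1.
have T0 k : 0 < T k by rewrite invr_gt0.
pose L k := \bigcap_N \bigcup_n exceed (T k) N n.
have mL k : measurable (L k).
  apply: bigcapT_measurable => N; apply: bigcupT_measurable => n.
  exact: measurable_exceed.
have PL k : P (L k) = 0%E.
  apply/eqP; rewrite eq_le measure_ge0 andbT; apply/lee_addgt0Pr => e' e'0.
  rewrite add0e; have [N PN] := prob_tail_small (T0 k) e'0.
  apply: le_trans PN; apply: le_measure.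
  - by apply: mem_set; exact: mL.
  - by apply: mem_set; apply: bigcupT_measurable => n; exact: measurable_exceed.
  - by move=> w; apply.
have : {ae P, forall w, forall k, ~ L k w}.
  apply: ae_foralln => k; exists (L k).
  by split; [exact: mL|exact: PL|move=> w /= /contrapT].
apply: filterS => w Lw; apply/cvgrPdist_le => e' e'0.
have [k Tk] : exists k, T k <= e'.
  exists (Num.bound e'^-1); rewrite /T -[leRHS]invrK lef_pV2 ?posrE ?invr_gt0//.
  apply: ltW; apply: lt_le_trans (archi_boundP _) _; first by rewrite invr_ge0 ltW.
  by rewrite ler_nat.
have [N /forallNP noexc] : exists N, ~ (exists n, exceed (T k) N n w).
  apply: contrapT => /forallNP all; apply: (Lw k) => N _.
  by have /contrapT[n en] := all N; exists n.
exists N.+1 => // -[//|n] /= Nn.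
rewrite sub0r normrN ger0_norm; last by rewrite divr_ge0// powR_ge0.
apply: le_trans Tk; rewrite ler_pdivrMr ?powR_gt0//.
have := noexc n; rewrite /exceed /exceeds /= => /negP; rewrite -leNgt.
have -> : 2 * (T k / 2) = T k by rewrite mulrCA divff ?mulr1.
by rewrite /weight (maxn_idPr (ltnW Nn)).
Qed.

End Bounds.

(** * The theorem *)

Lemma ereal_sup_gt_exceed d (Omega : measurableType d) d' (S : measurableType d')
    (R : realType) (B : completeNormedModType R) (p t : R) m
    (xi : nat -> Omega -> S) (h : m.+1.-tuple S -> B) :
  [set w | (t%:E < ereal_sup [set
     (`|Usum h (xi ^~ w) n| / n%:R `^ (m.+1%:R / p))%R%:E
     | n in [set n | (m.+1 <= n)%N]])%E] =
  \bigcup_(n in [set n | (m <= n)%N]) exceed p xi h t 0 n.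
Proof.
have eqv w n : exceed p xi h t 0 n w <->
    t < `|Usum h (xi ^~ w) n.+1| / n.+1%:R `^ (m.+1%:R / p).
  rewrite /exceed /exceeds /= weight0 Usum_incs -/(ustat xi h w n.+1).
  by rewrite mulrCA divff// mulr1 ltr_pdivlMr// powR_gt0.
apply/seteqP; split=> w /=.
  move=> /ereal_sup_gt[_ [[//|n] /= mn <-]]; rewrite lte_fin => tn.
  by exists n => //; apply/eqv.
move=> [n /= mn /eqv tn]; apply: (@lt_le_trans _ _
  (`|Usum h (xi ^~ w) n.+1| / n.+1%:R `^ (m.+1%:R / p))%:E); first by rewrite lte_fin.
by apply: ereal_sup_ubound; exists n.+1.
Qed.

Theorem theorem2p1 (R : realType) (B : completeNormedModType R) (r : R) :
  separable B -> 1 < r <= 2 -> smooth B r ->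
  forall p : R, 1 < p < r ->
  exists K : R,
  forall (m : nat) (d d' : measure_display) (Omega : measurableType d)
    (S : measurableType d') (P : probability Omega R)
    (xi : nat -> Omega -> S) (h : m.-tuple S -> B),
  (2 <= m)%N ->
  iid P xi ->
  borel_measurable h ->
  (forall l0 : 'I_m,
     is_cond_expectation P (sigma_of xi [set j | (j < m)%N /\ j <> l0])
       (fun w => h [tuple xi k w | k < m]) (fun=> 0)) ->
  (ereal_sup [set ((t `^ p)%:E *
       P [set w | t%:E < ereal_sup [set
            (`|Usum h (xi ^~ w) n| / n%:R `^ (m%:R / p))%R%:E
            | n in [set n | (m <= n)%N]]])%E
     | t in [set t : R | 0 < t]%R]
   <= K%:E * 'E_P[fun w => (`|h [tuple xi k w | k < m]| `^ p)%R])%E /\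
  (('E_P[fun w => (`|h [tuple xi k w | k < m]| `^ p)%R] < +oo)%E ->
   {ae P, forall w,
     `|Usum h (xi ^~ w) n| / n%:R `^ (m%:R / p) @[n --> \oo] --> (0 : R)}).
Proof.
move=> sepB r12 smB p /andP[p1 pr]; have [_ r2] := andP r12.
have [C C1 HC] := chaos_excess r12 smB.
have [phi nphi] := separable_norming sepB.
exists (2 * truncation_constant p r * expR (8 * C)).
move=> [//|m] d d' Omega S P xi h _ iidxi mh deg.
have K0 : 0 < 2 * truncation_constant p r * expR (8 * C).
  by rewrite !mulr_gt0 ?expR_gt0 ?truncation_constant_gt0.
rewrite unlock.
have E0 : (0 <= \int[P]_w (`|h [tuple xi k w | k < m.+1]| `^ p)%:E)%E.
  by apply: integral_ge0 => w _; rewrite lee_fin powR_ge0.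
case EE : (\int[P]_w (`|h [tuple xi k w | k < m.+1]| `^ p)%:E)%E => [e||].
- split=> [|_]; last first.
    apply: filterS (ae_cvg_ustat p1 pr r2 C1 HC nphi iidxi mh deg EE) => w.
    have -> // : (fun n => `|Usum h (xi ^~ w) n| / n%:R `^ (m.+1%:R / p)) =
        (fun n => `|ustat xi h w n| / n%:R `^ (m.+1%:R / p)).
      by apply/funext => n; rewrite Usum_incs.
  apply: ge_ereal_sup => _ [t t0 <-]; rewrite -EFinM.
  rewrite ereal_sup_gt_exceed.
  apply: le_trans (prob_sup_le p1 pr r2 C1 HC nphi iidxi mh deg EE t0).
  apply: lee_wpmul2l; first by rewrite lee_fin powR_ge0.
  have mex n : measurable (exceed p xi h t 0 n) by exact: (measurable_exceed p nphi iidxi mh).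
  apply: le_measure.
  + by apply: mem_set; apply: bigcup_measurable => n _; exact: mex.
  + by apply: mem_set; apply: bigcupT_measurable.
  + by move=> w [n _ wn]; exists n.
- split; last by rewrite ltxx.
  by rewrite gt0_muley ?lte_fin// leey.
- by rewrite EE in E0.
Qed.
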